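(* Let $Y\subset\Sigma^{\mathbb Z}$ and $Z\subset(\Sigma^2)^{\mathbb Z}$ be sofic shifts such that $Z\cap Y^2$ is an equivalence relation on $Y$. Then for some $c\in\mathbb N$ there is a unique maximal pseudometric $d:Y^2\to\mathbb R_+$ satisfying $$\forall x,y\in Y\ \forall n\in\mathbb N:\quad d(x,y)\le d_{cn}\big(x_{[-cn,cn]},y_{[-cn,cn]}\big)/2^{n-1}.$$ This function $d$ metrizes $Y/Z$ (that is, $d(x,y)=0\iff(x,y)\in Z$ for $x,y\in Y$, and the metric induced by $d$ on $Y/Z$ induces the quotient topology). It is upper semicomputable, and given points $x,y\in Y$ and $\epsilon>0$, one can effectively compute a rational $r$ such that $d(x,y)\in[r,\tfrac52 r+\epsilon]$. The obvious analog holds for sofic shifts $Y\subset\Sigma^{\mathbb N}$ and $Z\subset(\Sigma^2)^{\mathbb N}$ such that $Z\cap Y^2$ is an equivalence relation on $Y$, using prefixes $x_{[0,cn]}$ in place of the central words $x_{[-cn,cn]}$ (and correspondingly graphs on the words of $Y$ of length $m+1$, with edges defined by prefix cylinders).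
   Context: For $M\in\{\mathbb N,\mathbb Z\}$ (with $0\in\mathbb N$), a subshift is a closed shift-invariant subset of $\Sigma^M$, where $\Sigma$ is a finite alphabet. It is an SFT if it is defined by a finite set of forbidden words, and sofic if it is the image of an SFT under a continuous shift-commuting map. $(\Sigma^2)^M$ is identified with $\Sigma^M\times\Sigma^M$. $Y/Z$ denotes the topological quotient of $Y$ by the equivalence relation $Z\cap Y^2$. $\mathbb R_+$ denotes the nonnegative real numbers. For $m\in\mathbb N$, $d_m$ is the path metric in the graph whose nodes are the words of length $2m+1$ occurring in points of $Y$, with an edge $(u,v)$ if and only if $([u]\times[v])\cap Z\neq\emptyset$, where $[u]=\{y\in Y: y_{[-m,m]}=u\}$. Each node has a self-loop, and the convention is $d_m(u,u)=1$ (the shortest route from a node to itself uses the self-loop). The auxiliary distance $d_m$ may take the value $\infty$, when there is no path. Maximality of $d$ is with respect to the pointwise order. Computability: points of $Y$ are given as oracles, and $Y,Z$ are given by finite descriptions (e.g. finite automata). Upper semicomputable means that from $x,y$ one can effectively enumerate a sequence of upper bounds converging to $d(x,y)$.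
   Formalization: The pseudometric d takes values in [0,+∞] instead of R_+ (and r may be +∞ when d is): if Y={0^Z,1^Z} and Z is the diagonal, all d_m between the two points are ∞ and no maximal finite d exists; d(x,y) is finite whenever d_0 is. *)

(* Defs.v *)
From HB Require Import structures.
From mathcomp Require Import all_boot all_order all_algebra generic_quotient.
From mathcomp Require Import all_classical all_reals all_analysis.

Set Implicit Arguments.
Unset Strict Implicit.
Unset Printing Implicit Defensive.

Import Order.TTheory GRing.Theory Num.Theory.
Import numFieldNormedType.Exports.

Local Open Scope classical_set_scope.
Local Open Scope ring_scope.
Local Open Scope quotient_scope.

Inductive time := one_sided | two_sided.

Definition idx (M : time) : Type := if M is one_sided then nat else int.

Definition succ_idx (M : time) : idx M -> idx M :=
  match M with one_sided => succn | two_sided => fun i : int => i + 1 end.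

Definition advance (M : time) (i : idx M) (j : nat) : idx M := iter j (@succ_idx M) i.

(* [0, m] on [nat] and [-m, m] on [int]. *)
Definition window (M : time) (m : nat) : seq (idx M) :=
  match M with
  | one_sided => iota 0 m.+1
  | two_sided => [seq i%:Z - m%:Z | i <- iota 0 (2 * m).+1]
  end.

Definition config (M : time) (S : finType) : Type :=
  {ptws idx M -> discrete_topology S}.

Definition shift_map M (S : finType) (x : config M S) : config M S :=
  fun i => x (succ_idx i).

Definition word M (S : finType) (m : nat) (x : config M S) : seq S :=
  [seq (x i : S) | i <- window M m].

Definition pairing M (S : finType) (x y : config M S) : config M (S * S)%type :=
  fun i => (x i, y i).

Definition occurs M (S : finType) (w : seq S) (x : config M S) : Prop :=
  exists i : idx M, w = [seq (x (advance i j) : S) | j <- iota 0 (size w)].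

Definition sft M (S : finType) (F : seq (seq S)) : set (config M S) :=
  [set x | forall w, w \in F -> ~ occurs w x].

Definition sofic M (S : finType) (Y : set (config M S)) : Prop :=
  exists (G : finType) (F : seq (seq G)) (f : config M G -> config M S),
    [/\ {within sft F, continuous f},
        forall x, sft F x -> f (shift_map x) = shift_map (f x)
      & Y = f @` sft F].

(* Finite automata: lists of labelled edges between states in [nat]; every
   state is both initial and final. *)
Definition automaton (S : finType) := seq (nat * S * nat).

Definition presents M (S : finType) (A : automaton S) (Y : set (config M S)) :
    Prop :=
  Y = [set x | exists q : idx M -> nat,
                 forall i, (q i, x i : S, q (succ_idx i)) \in A].

Definition glued M (S : finType) (Y : set (config M S))
  (Z : set (config M (S * S)%type)) : rel Y :=
  fun x y => `[< Z (pairing (set_val x) (set_val y)) >].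
Arguments glued {M S} Y Z.

Definition quotient_space M (S : finType) (Y : set (config M S))
  (Z : set (config M (S * S)%type)) (hZ : equiv_class_of (glued Y Z)) : Type :=
  quotient_topology {eq_quot (EquivRelPack hZ)}.
HB.instance Definition _ M S Y Z hZ :=
  Topological.on (@quotient_space M S Y Z hZ).
HB.instance Definition _ M S Y Z hZ :=
  Quotient.on (@quotient_space M S Y Z hZ).

(* Endpoints of edges are automatically words of [Y]. *)
Definition edge M (S : finType) (Y : set (config M S))
    (Z : set (config M (S * S)%type)) (m : nat) (u v : seq S) : Prop :=
  exists x y, [/\ Y x, Y y, word m x = u, word m y = v & Z (pairing x y)].

Fixpoint walk (T : Type) (E : T -> T -> Prop) (l : nat) (u v : T) : Prop :=
  if l is l'.+1 then exists2 w, E u w & walk E l' w v else u = v.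

(* Only walks of positive length count, so that [d_m(u,u) = 1] through the
   self-loop at [u]; the infimum of the empty set is [+oo]. *)
Definition graph_dist (R : realType) M (S : finType) (Y : set (config M S))
    (Z : set (config M (S * S)%type)) (m : nat) (u v : seq S) : \bar R :=
  ereal_inf [set l%:R%:E | l in [set l : nat | (0 < l)%N /\
                                               walk (edge Y Z m) l u v]].

Section Metrics.
Local Open Scope ereal_scope.
Context (R : realType) (M : time) (S : finType) (Y : set (config M S)).
Context (Z : set (config M (S * S)%type)).
Implicit Type d : Y -> Y -> \bar R.

(* Extended-valued: if no walk in [edge Y Z 0] joins the words of [x] and [y],
   then no [point_dist m x y] is finite, the condition below bounds [d x y] by
   no finite value, and there is no maximal finite-valued solution. *)
Definition pseudometric d : Prop :=
  [/\ forall x y, 0 <= d x y, forall x, d x x = 0,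
      forall x y, d x y = d y x & forall x y z, d x z <= d x y + d y z].

Definition point_dist (m : nat) (x y : Y) : \bar R :=
  graph_dist R Y Z m (word m (set_val x)) (word m (set_val y)).

Definition admissible (c : nat) d : Prop :=
  pseudometric d /\
  forall x y (n : nat),
    d x y <= point_dist (c * n) x y / ((2 : R) ^ (n%:Z - 1))%:E.

Definition maximal_admissible (c : nat) d : Prop :=
  admissible c d /\
  forall d', admissible c d' -> (forall x y, d x y <= d' x y) -> d' = d.

Definition quotient_dist (hZ : equiv_class_of (glued Y Z)) d
  (p q : quotient_space hZ) : \bar R := d (repr p) (repr q).

Definition metrizes (hZ : equiv_class_of (glued Y Z)) d : Prop :=
  (forall x y, d x y = 0 <-> Z (pairing (set_val x) (set_val y))) /\
  forall U : set (quotient_space hZ),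
    open U <->
    forall p, U p ->
      exists2 e : R, (0 < e)%R & forall q, quotient_dist d p q < e%:E -> U q.

End Metrics.

(* Partial recursive functions on the types generated from [nat] by products
   and lists: identity, composition, pairing, primitive recursion on [nat] and
   on lists, unbounded minimization, and queries to two oracles
   [nat -> nat]. *)
Inductive ty := Nat | Prod of ty & ty | List of ty.

Fixpoint value (t : ty) : Type :=
  match t with
  | Nat => nat
  | Prod a b => (value a * value b)%type
  | List a => seq (value a)
  end.

Inductive prog : ty -> ty -> Type :=
| Id a : prog a a
| Comp a b c : prog b c -> prog a b -> prog a c
| Pair a b c : prog a b -> prog a c -> prog a (Prod b c)
| Fst a b : prog (Prod a b) a
| Snd a b : prog (Prod a b) b
| Zero a : prog a Nat
| Succ : prog Nat Nat
| NatRec a b : prog a b -> prog (Prod a (Prod Nat b)) b -> prog (Prod a Nat) b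
| Nil a b : prog a (List b)
| Cons a : prog (Prod a (List a)) (List a)
| ListRec a b c : prog a c -> prog (Prod a (Prod b (Prod (List b) c))) c ->
    prog (Prod a (List b)) c
| Mu a : prog (Prod a Nat) Nat -> prog a Nat
| Query : bool -> prog Nat Nat.

Fixpoint nat_rec_rel (A B : Type) (F : A -> B -> Prop)
    (G : A * (nat * B) -> B -> Prop) (x : A) (n : nat) (w : B) : Prop :=
  if n is n'.+1 then exists2 u, nat_rec_rel F G x n' u & G (x, (n', u)) w
  else F x w.

Fixpoint list_rec_rel (A B C : Type) (F : A -> C -> Prop)
    (G : A * (B * (seq B * C)) -> C -> Prop) (x : A) (s : seq B) (w : C) :
    Prop :=
  if s is h :: t then exists2 u, list_rec_rel F G x t u & G (x, (h, (t, u))) w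
  else F x w.

(* [run o p v w]: on input [v] with oracles [o], [p] halts with output [w]. *)
Fixpoint run (o : bool -> nat -> nat) a b (p : prog a b) :
    value a -> value b -> Prop :=
  match p in prog a b return value a -> value b -> Prop with
  | Id _ => fun v w => w = v
  | Comp _ _ _ f g => fun v w => exists2 u, run o g v u & run o f u w
  | Pair _ _ _ f g => fun v w => run o f v w.1 /\ run o g v w.2
  | Fst _ _ => fun v w => w = v.1
  | Snd _ _ => fun v w => w = v.2
  | Zero _ => fun _ w => w = 0%N
  | Succ => fun v w => w = v.+1
  | NatRec _ _ f g => fun v w => nat_rec_rel (run o f) (run o g) v.1 v.2 w
  | Nil _ _ => fun _ w => w = [::]
  | Cons _ => fun v w => w = v.1 :: v.2
  | ListRec _ _ _ f g => fun v w => list_rec_rel (run o f) (run o g) v.1 v.2 w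
  | Mu _ f => fun v n => run o f (v, n) 0%N /\
      forall m, (m < n)%N -> exists k, run o f (v, m) k.+1
  | Query j => fun n w => w = o j n
  end.

Lemma run_functional o a b (p : prog a b) v w w' :
  run o p v w -> run o p v w' -> w = w'.
Proof.
elim: p v w w' => {a b} /=
  [a|a b c f IHf g IHg|a b c f IHf g IHg|a b|a b|a||a b f IHf g IHg|a b|a
  |a b c f IHf g IHg|a f IHf|j] v w w'; try by move=> -> ->.
- by move=> [u gu fu] [u' gu' fu']; rewrite (IHg _ _ _ gu' gu) in fu';
    exact: IHf fu fu'.
- case: w w' => [w1 w2] [w1' w2'] /= [f1 g1] [f2 g2].
  by rewrite (IHf _ _ _ f1 f2) (IHg _ _ _ g1 g2).
- case: v => [x n] /=; elim: n w w' => [|n IHn] w w' /=; first exact: IHf.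
  by move=> [u hu gu] [u' hu' gu']; rewrite (IHn _ _ hu' hu) in gu';
    exact: IHg gu gu'.
- case: v => [x s] /=; elim: s w w' => [|h t IHs] w w' /=; first exact: IHf.
  by move=> [u hu gu] [u' hu' gu']; rewrite (IHs _ _ hu' hu) in gu';
    exact: IHg gu gu'.
- move=> [f0 fS] [f0' fS']; case: (ltngtP w w') => // lt_w.
  + by have [k /(IHf _ _ _ f0)] := fS' _ lt_w.
  + by have [k /(IHf _ _ _ f0')] := fS _ lt_w.
Qed.

(* A letter is given by its rank in the enumeration of the alphabet; an integer
   index by its rank in 0, -1, 1, -2, 2, ... *)
Definition letter_code (S : finType) (s : S) : nat := enum_rank s.

Definition idx_of_nat (M : time) : nat -> idx M :=
  match M with
  | one_sided => id
  | two_sided => fun n => if odd n then Negz n./2 else Posz n./2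
  end.

Definition oracles M (S : finType) (x y : config M S) : bool -> nat -> nat :=
  fun j n => letter_code ((if j then y else x) (idx_of_nat M n) : S).

Definition Edges1 : ty := List (Prod (Prod Nat Nat) Nat).
Definition Edges2 : ty := List (Prod (Prod Nat (Prod Nat Nat)) Nat).

Definition code1 (S : finType) (A : automaton S) : value Edges1 :=
  [seq (e.1.1, letter_code e.1.2, e.2) | e <- A].

Definition code2 (S : finType) (B : automaton (S * S)%type) : value Edges2 :=
  [seq (e.1.1, (letter_code e.1.2.1, letter_code e.1.2.2), e.2) | e <- B].

(* [(a, b)] stands for [a / b] in the extended reals; [(1, 0)] stands for
   [+oo], because [0^-1 = +oo] there. *)
Definition Rational : ty := Prod Nat Nat.

Definition erational (R : realType) (r : value Rational) : \bar R :=
  (r.1%:R%:E / r.2%:R%:E)%E.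

Section Effectivity.
Local Open Scope ereal_scope.
Context (R : realType) (M : time) (S : finType) (Y : set (config M S)).
Context (A : automaton S) (B : automaton (S * S)%type).

Definition upper_semicomputed
    (p : prog (Prod (Prod Edges1 Edges2) Nat) Rational)
    (d : Y -> Y -> \bar R) : Prop :=
  forall x y : Y, exists r : nat -> value Rational,
    [/\ forall k, run (oracles (set_val x) (set_val y)) p
                    ((code1 A, code2 B), k) (r k),
        forall k, d x y <= erational R (r k)
      & erational R (r k) @[k --> \oo] --> d x y].

Definition approximated
    (p : prog (Prod (Prod Edges1 Edges2) Rational) Rational)
    (d : Y -> Y -> \bar R) : Prop :=
  forall (x y : Y) (e : value Rational), (0 < e.1)%N -> (0 < e.2)%N ->
  exists r : value Rational,
    [/\ run (oracles (set_val x) (set_val y)) p ((code1 A, code2 B), e) r,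
        erational R r <= d x y
      & d x y <= (5 / 2)%:E * erational R r + erational R e].

End Effectivity.

(* Main.v *)
Require Import Defs.
From mathcomp Require Import all_boot all_order all_algebra generic_quotient.
From mathcomp Require Import all_classical all_reals all_analysis.
From mathcomp Require Import zify ring lra.

(* Call an edge of the graph of the words on the window m a step of window m.  A
   cycle in a path of a finite automaton can be repeated, so a finite path
   extends, after losing a margin c on each side of the window, to an infinite
   one.  Applied to three edges of the product automaton of Y, Y and Z at once,
   this shows that three consecutive steps of window m + c can be replaced by one
   step of window m, because the relation is transitive.  Let d be the infimum of
   the costs of chains, where a step of window cn costs 2^(1-n).  By Frink's
   argument d(x,y) < 2^(1-n) forces a step of window cn from x to y.  So d is the
   maximal pseudometric, and compactness gives the quotient topology.  The minimal
   cost w_N of a chain of steps of windows at most cN is computable as a shortest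
   path between words, and d <= w_N <= 2 d + 2^(1-N), so that
   r = (w_N - 2^(1-N)) / 2 approximates d. *)

Set Implicit Arguments.
Unset Strict Implicit.
Unset Printing Implicit Defensive.

Import Order.TTheory GRing.Theory Num.Theory.
Import numFieldNormedType.Exports.

(** * The window in terms of codes of indices *)

(** Both kinds of time are treated at once by numbering the indices, as 0, -1, 1, -2, 2, ... in the
    two-sided case: a window becomes an initial segment of the codes, and a point becomes the
    sequence of naturals that its oracle answers. Belonging to $Y$ then means being linked to itself
    by an infinite path of the product automaton. The cycles of three paths have to be repeated
    simultaneously, since repeating them separately would destroy the equality of the sequences in
    the middle; hence a constant $c$ of the order of the cube of the number of edges, which the
    programs compute from the automata. Three is the number of pieces that Frink's cut leaves: two
    halves and the step between them. Since each passage to a smaller window loses the same margin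
    $c$, the windows grow linearly while the costs decrease geometrically. Equality of points cannot
    be decided from oracles, but a step of window at most $cN$ depends only on the words on the
    window $cN$, so the search for a cheapest chain is finite. It yields $d \le 2r + 2^{1-N}$, which
    is stronger than the factor $5/2$ asks for. *)

Definition width (M : time) (m : nat) : nat :=
  match M with one_sided => m.+1 | two_sided => m.*2.+1 end.

(** Odd codes are negative indices, whose codes decrease towards zero. Truncated subtraction is
    intended: it sends the code 1 of -1 to the code 0 of 0. *)
Definition succ_code (M : time) (n : nat) : nat :=
  match M with
  | one_sided => n.+1
  | two_sided => if odd n then n - 2 else n.+2
  end.

Definition nat_of_idx (M : time) : idx M -> nat :=
  match M with
  | one_sided => id
  | two_sided => fun i => match i with Posz k => k.*2 | Negz k => k.*2.+1 end
  end.

Lemma idx_of_natK M : cancel (@idx_of_nat M) (@nat_of_idx M).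
Proof.
case: M => // n /=.
by case: ifP => n_odd; rewrite -[RHS]odd_double_half n_odd.
Qed.

Lemma nat_of_idxK M : cancel (@nat_of_idx M) (@idx_of_nat M).
Proof.
by case: M => // -[] n /=; rewrite /= odd_double ?doubleK //= uphalf_double.
Qed.

Lemma succ_idxE M n : succ_idx (idx_of_nat M n) = idx_of_nat M (succ_code M n).
Proof.
case: M => //=; case: ifP => n_odd /=; last by rewrite n_odd /=; lia.
case: ifP; last by lia.
case: n n_odd => [|[|[|n]]] //= /negbNE n_odd _.

lia.
Qed.

Lemma width_mono M m m' : m <= m' -> width M m <= width M m'.
Proof. by case: M; rewrite /= ?ltnS ?leq_double. Qed.

(** * Repetition of cycles in a sequence with finitely many values *)

Lemma pigeonhole_seq (T : eqType) (s : seq T) (e : nat -> T) m c :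
  (forall n, e n \in s) -> size s <= c ->
  exists i j : nat, [/\ m <= i, i < j, j <= m + c & e i = e j].
Proof.
move=> es sc; have /(uniqPn (e 0)) : ~~ uniq [seq e i | i <- iota m c.+1].
  apply/negP => e_uniq; have /(uniq_leq_size e_uniq) :
      {subset [seq e i | i <- iota m c.+1] <= s} by move=> _ /mapP[i _ ->].
  by rewrite size_map size_iota ltnNge sc.
rewrite size_map size_iota => -[i [j [ij jc]]].
rewrite !(nth_map 0) ?size_iota ?(ltn_trans ij) // !nth_iota ?(ltn_trans ij) //.
by move=> eij; exists (m + i), (m + j); split=> //; lia.
Qed.

Section Folding.
Variables (T : eqType) (s : seq T) (e : nat -> T) (m c : nat).
Hypotheses (es : forall n, e n \in s) (sc : size s <= c).

(** Two positions [i < j] beyond [m] carry the same value; [r] counts upwards and goes to [i]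
    whenever it would reach [j]. *)
Lemma fold_forward : exists r : nat -> nat,
  [/\ forall k, k <= m -> r k = k, forall k, r k < m + c
    & forall k, e (r k.+1) = e (r k).+1].
Proof.
have [i [j [mi ij jc eij]]] := pigeonhole_seq m es sc.
pose r k := iter k (fun a => if a.+1 == j then i else a.+1) 0%N.
have r_lt k : r k < j by elim: k => /= [|k IHk]; [lia | case: eqP; lia].
have r_id k : k < j -> r k = k.
  by elim: k => //= k IHk kj; rewrite IHk ?(ltnW kj) //; case: eqP kj; lia.
exists r; split=> [k km | k | k /=]; first by apply: r_id; lia.
  exact: leq_trans (r_lt k) jc.
by case: eqP => // ->.
Qed.

(** On the negative half line the successor moves towards the window, so the value to be matched is
    that at the predecessor of the new position. The jump therefore leads from [j] to [i.+1], whose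
    predecessor [i] carries the value of [j]. *)
Lemma fold_backward : exists r : nat -> nat,
  [/\ forall k, k <= m -> r k = k, forall k, r k <= m + c,
      forall k, 0 < r k.+1 & forall k, e (r k) = e (r k.+1).-1].
Proof.
have [i [j [mi ij jc eij]]] := pigeonhole_seq m es sc.
pose r k := iter k (fun a => if a == j then i.+1 else a.+1) 0%N.
have r_le k : r k <= j by elim: k => //= k IHk; case: eqP; lia.
have r_id k : k <= j -> r k = k.
  by elim: k => //= k IHk kj; rewrite IHk ?(ltnW kj) //; case: eqP kj; lia.
exists r; split=> [k km | k | k /= | k /=]; first by apply: r_id; lia.
- exact: leq_trans (r_le k) jc.
- by case: eqP.
- by case: eqP => // ->.
Qed.

End Folding.

(** The half lines on the two sides of the window are folded independently of each other. At a jump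
    [phi] does not commute with the successor; only the values of [e] match, which is all that a
    path of edges needs. Both [phi n] and its successor stay in the enlarged window, so [e] is
    consulted only there. *)
Lemma pumping M (T : eqType) (s : seq T) (e : nat -> T) m c :
  (forall n, e n \in s) -> size s <= c ->
  exists phi : nat -> nat,
  [/\ forall n, n < width M m -> phi n = n,
      forall n, phi n < width M (m + c),
      forall n, succ_code M (phi n) < width M (m + c)
    & forall n, e (phi (succ_code M n)) = e (succ_code M (phi n))].
Proof.
move=> es sc; case: M; rewrite /width.
  have [r [r_id r_lt re]] := fold_forward m es sc.
  exists r; split=> n /=; [exact: r_id | | | exact: re].
    by have := r_lt n; lia.
  by have := r_lt n; lia.
have [r [r_id r_lt re]] :=
  fold_forward m (e := fun k => e k.*2) (fun=> es _) sc.
(* [k.*2.-1] is the code of [-k], and truncation makes it the code of 0 for [k = 0], where the two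
   halves meet. *)
have [l [l_id l_le l_gt0 le]] :=
  fold_backward m (e := fun k => e k.*2.-1) (fun=> es _) sc.
pose phi n := if odd n then (l n./2.+1).*2.-1 else (r n./2).*2.
have phi_even k : phi k.*2 = (r k).*2 by rewrite /phi odd_double doubleK.
have phi_odd k : phi k.*2.+1 = (l k.+1).*2.-1.
  by rewrite /phi /= odd_double /= uphalf_double.
have succ_even k : succ_code two_sided k.*2 = k.+1.*2.
  by rewrite /= odd_double.
have succ_odd k : succ_code two_sided k.*2.+1 = k.*2.-1.
  by rewrite /= odd_double /= subSS subn1.
have dbl_pred k : 0 < k -> k.*2.-1 = k.-1.*2.+1 by lia.
have parity n : {k | n = k.*2 \/ n = k.*2.+1}.
  by exists n./2; have := odd_double_half n; case: (odd n); [right|left]; lia.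
exists phi; split=> n; have [k [->|->]] := parity n.
- by rewrite phi_even => nm; rewrite r_id; lia.
- by rewrite phi_odd => nm; rewrite l_id; lia.
- by rewrite phi_even; have := r_lt k; lia.
- by rewrite phi_odd; have := l_le k.+1; lia.
- by rewrite phi_even [succ_code _ _]succ_even; have := r_lt k; lia.
- rewrite phi_odd dbl_pred // [succ_code _ _]succ_odd.
  by have := l_le k.+1; have := l_gt0 k; lia.
- by rewrite phi_even !succ_even phi_even re.
- rewrite phi_odd dbl_pred // !succ_odd.
  case: k => [|k].
    by rewrite (phi_even 0) r_id //; have := le 0; rewrite l_id.
  by rewrite [k.+1.*2.-1]/= phi_odd le.
Qed.

(** * Pairs of sequences that label an infinite path, and their restrictions to windows *)

Section Near.
Variables (M : time) (Q : eqType) (P : seq (Q * (nat * nat) * Q)).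
Implicit Types x y z : nat -> nat.

Definition linked x y : Prop :=
  exists q : nat -> Q, forall n, (q n, (x n, y n), q (succ_code M n)) \in P.

Definition agree m x y : Prop := forall n, n < width M m -> x n = y n.

(** An edge of the graph on the words of window [m], expressed on coded sequences. *)
Definition nearby m x y : Prop :=
  exists x' y', [/\ linked x' y', agree m x' x & agree m y' y].

Lemma agreeC m x y : agree m x y -> agree m y x.
Proof. by move=> xy n nm; rewrite xy. Qed.

Lemma agree_trans m y x z : agree m x y -> agree m y z -> agree m x z.
Proof. by move=> xy yz n nm; rewrite xy ?yz. Qed.

Lemma agree_le m m' x y : m <= m' -> agree m' x y -> agree m x y.
Proof. by move=> mm' xy n nm; apply: xy; apply: leq_trans (width_mono M mm'). Qed.

Lemma nearby_le m m' x y : m <= m' -> nearby m' x y -> nearby m x y.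
Proof.
by move=> mm' [x' [y' [xy xx' yy']]]; exists x', y'; split=> //; exact: agree_le mm' _.
Qed.

Lemma nearby_agree m x x' y y' :
  agree m x x' -> agree m y y' -> nearby m x y -> nearby m x' y'.
Proof.
move=> xx' yy' [u [v [uv ux vy]]]; exists u, v.
by split=> //; [exact: agree_trans xx' | exact: agree_trans yy'].
Qed.

Lemma linked_nearby m x y : linked x y -> nearby m x y.
Proof. by exists x, y. Qed.

Lemma nearby_sym : (forall x y, linked x y -> linked y x) ->
  forall m x y, nearby m x y -> nearby m y x.
Proof. by move=> sym m x y [x' [y' [/sym xy ? ?]]]; exists y', x'. Qed.

Definition finite_path l (t : seq (Q * (nat * nat) * Q)) : Prop :=
  [/\ size t = l, {subset t <= P}
    & forall d n, n < l -> succ_code M n < l ->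
        (nth d t n).2 = (nth d t (succ_code M n)).1.1].

(* Repeating a cycle on either side of the window turns a finite path into an
   infinite one; this is where the number of edges enters the constant. *)
Lemma nearby_finite m c d x y : size P <= c ->
  nearby m x y <->
  exists t, finite_path (width M (m + c)) t /\
    forall n, n < width M m -> (nth d t n).1.2 = (x n, y n).
Proof.
move=> Pc; split=> [[x' [y' [[q qP] xx' yy']]] | [t [[t_sz tP t_adj] txy]]].
  exists (mkseq (fun n => (q n, (x' n, y' n), q (succ_code M n)))
    (width M (m + c))); split; first split=> [|e /mapP[n _ ->] //|e n nc Snc].
  - by rewrite size_mkseq.
  - by rewrite !nth_mkseq.
  - move=> n nm; rewrite nth_mkseq /= ?xx' ?yy' //.
    by apply: leq_trans nm (width_mono _ _); exact: leq_addr.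
have t0 : 0 < size t by rewrite t_sz; case: (M).
(* With the first edge as default value the sequence of edges stays in [P] beyond the end of [t], as
   [pumping] requires. *)
pose e0 := nth d t 0.
have eP n : nth e0 t n \in P.
  have [nt|tn] := ltnP n (size t); first by apply/tP/mem_nth.
  by rewrite nth_default //; apply/tP/mem_nth.
have [phi [phi_id phi_lt phiS_lt e_phi]] := pumping M m eP Pc.
exists (fun n => (nth e0 t (phi n)).1.2.1), (fun n => (nth e0 t (phi n)).1.2.2).
have nth_m n : n < width M m -> nth e0 t (phi n) = nth d t n.
  move=> nm; rewrite phi_id //; apply: set_nth_default.
  by rewrite t_sz (leq_trans nm) ?width_mono ?leq_addr.
split=> [|n nm|n nm]; [|by rewrite nth_m ?txy..].
exists (fun n => (nth e0 t (phi n)).1.1) => n.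
(* The edge used at the successor of [n] is the one that follows [phi n] in [t], so it starts where
   the edge used at [n] ends. *)
rewrite e_phi -t_adj //.
by have := eP (phi n); case: (nth _ _ _) => [[? []]].
Qed.

Hypothesis linked_trans : forall x y z, linked x y -> linked y z -> linked x z.

(** One map [phi] pumps the triple of paths, whence the cube. The middle sequences agree only on the
    larger window, but [phi] takes all its values there, so after composition with [phi] they agree
    everywhere and transitivity applies. *)
Lemma nearby_cube m c x y z w : size P ^ 3 <= c ->
  nearby (m + c) x y -> nearby (m + c) y z -> nearby (m + c) z w -> nearby m x w.
Proof.
move=> Pc [x1 [y1 [[q1 P1] xx1 yy1]]] [x2 [y2 [[q2 P2] xx2 yy2]]].
move=> [x3 [y3 [[q3 P3] xx3 yy3]]].
pose P3s := [seq (p.1, p.2, r) | p <- [seq (p, r) | p <- P, r <- P], r <- P].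
pose e n := ((q1 n, (x1 n, y1 n), q1 (succ_code M n)),
  (q2 n, (x2 n, y2 n), q2 (succ_code M n)),
  (q3 n, (x3 n, y3 n), q3 (succ_code M n))).
have eP n : e n \in P3s.
  apply/allpairsP; exists (((e n).1.1, (e n).1.2), (e n).2); split=> //=.
  by apply: allpairs_f; [exact: P1 | exact: P2].
have P3c : size P3s <= c by rewrite !size_allpairs -mulnA.
have [phi [phi_id phi_lt _ e_phi]] := pumping M m eP P3c.
have agree_phi u v : agree (m + c) u v -> u \o phi = v \o phi.
  by move=> uv; apply/funext => n /=; rewrite uv.
have agree_m u v : agree (m + c) u v -> agree m (u \o phi) v.
  by move=> uv n nm /=; rewrite uv // phi_id.
exists (x1 \o phi), (y3 \o phi); split; [|exact: agree_m | exact: agree_m].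
have E1 : y1 \o phi = x2 \o phi.
  by apply: agree_phi; apply: agree_trans yy1 _; exact: agreeC.
have E2 : y2 \o phi = x3 \o phi.
  by apply: agree_phi; apply: agree_trans yy2 _; exact: agreeC.
apply: (@linked_trans _ (y1 \o phi)).
  by exists (q1 \o phi) => n /=; have /(congr1 (fun w => w.1.1.1.1)) /= -> := e_phi n; exact: P1.
apply: (@linked_trans _ (y2 \o phi)).
  rewrite E1; exists (q2 \o phi) => n /=.
  by have /(congr1 (fun w => w.1.2.1.1)) /= -> := e_phi n; exact: P2.
rewrite E2; exists (q3 \o phi) => n /=.
by have /(congr1 (fun w => w.2.1.1)) /= -> := e_phi n; exact: P3.
Qed.

End Near.

(** * Chains and Frink's metrization *)

Section Chains.
Local Open Scope ring_scope.
Variables (R : realType) (T : Type) (V : nat -> T -> T -> Prop).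
Implicit Types (x y z : T) (s : seq (nat * T)).

Definition weight (n : nat) : R := 2 / 2 ^+ n.

Definition cost s : R := \sum_(e <- s) weight e.1.

Fixpoint chain x s y : Prop :=
  if s is e :: s' then V e.1 x e.2 /\ chain e.2 s' y else x = y.

Lemma weight_gt0 n : 0 < weight n.
Proof. by rewrite divr_gt0 ?exprn_gt0. Qed.

Lemma weightS n : weight n = 2 * weight n.+1.
Proof. by rewrite /weight exprS; field; rewrite expf_neq0. Qed.

Lemma weight_le m n : (m <= n)%N -> weight n <= weight m.
Proof. by move=> mn; rewrite ler_pM2l // lef_pV2 ?posrE ?exprn_gt0 // ler_eXn2l ?ltr1n. Qed.

Lemma ltn_weight m n : weight n < weight m -> (m < n)%N.
Proof. by rewrite ltnNge; apply: contraTN => /weight_le; rewrite -leNgt. Qed.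

Lemma weight_small (e : R) : 0 < e -> exists n, weight n < e.
Proof.
move=> e0; have /archi_boundP := ltW (divr_gt0 (ltr0Sn R 1) e0).
set n := Num.Def.archi_bound _; rewrite ltr_pdivrMr // => en.
exists n; rewrite ltr_pdivrMr ?exprn_gt0 // (lt_le_trans en) // mulrC ler_pM2l //.
by rewrite -natrX ler_nat ltnW // ltn_expl.
Qed.

(** The cost as a natural number of units [weight N], on which the algorithm can operate; it is
    exact when no level exceeds [N]. *)
Definition units N s : nat := \sum_(e <- s) 2 ^ (N - e.1).

Lemma cost_nil : cost [::] = 0. Proof. exact: big_nil. Qed.

Lemma cost_cons e s : cost (e :: s) = weight e.1 + cost s.
Proof. exact: big_cons. Qed.

Lemma cost_cat s1 s2 : cost (s1 ++ s2) = cost s1 + cost s2.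
Proof. exact: big_cat. Qed.

Lemma cost_ge0 s : 0 <= cost s.
Proof. by apply: sumr_ge0 => e _; apply/ltW/weight_gt0. Qed.

Definition costE := (cost_nil, cost_cons, cost_cat).

Lemma chain_cat x s1 s2 y :
  chain x (s1 ++ s2) y <-> exists2 z, chain x s1 z & chain z s2 y.
Proof.
elim: s1 x => [|e s1 IHs1] x /=.
  by split=> [|[z ->]]; [exists x | ].
split=> [[xe /IHs1[z ez zy]]|[z [xe ez] zy]]; first by exists z.
by split=> //; apply/IHs1; exists z.
Qed.

(** [e] is the step during which the running cost passes [h]. *)
Lemma split_cost s (h : R) : 0 <= h -> h < cost s ->
  exists s1 e s2, [/\ s = s1 ++ e :: s2, cost s1 <= h & h < cost s1 + weight e.1].
Proof.
elim: s h => [|e s IHs] h h0; first by rewrite cost_nil ltNge h0.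
rewrite cost_cons => hs; have [eh|he] := leP (weight e.1) h.
  have [||s1 [e' [s2 [-> s1h hs1]]]] := IHs (h - weight e.1); [lra..|].
  by exists (e :: s1), e', s2; rewrite cost_cons; split=> //; lra.
by exists [::], e, s; rewrite cost_nil; split=> //; lra.
Qed.

Lemma cost_units N s : all (fun e => e.1 <= N)%N s ->
  cost s = (units N s)%:R * weight N.
Proof.
rewrite /units; elim: s => [|e s IHs] /=; first by rewrite big_nil cost_nil mul0r.
move=> /andP[eN /IHs sN]; rewrite big_cons cost_cons sN natrD mulrDl; congr (_ + _).
have -> : weight N = 2 / (2 ^+ (N - e.1) * 2 ^+ e.1) by rewrite -exprD subnK.
rewrite /weight natrX.
by field; rewrite !expf_neq0.
Qed.

Lemma units_gt0 N s : (0 < size s -> 0 < units N s)%N.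
Proof. by case: s => // e s _; rewrite /units big_cons addn_gt0 expn_gt0. Qed.

Hypothesis V_refl : forall n x, V n x x.
Hypothesis V_cube :
  forall n x y z w, V n.+1 x y -> V n.+1 y z -> V n.+1 z w -> V n x w.

Lemma V_le m n x y : (m <= n)%N -> V n x y -> V m x y.
Proof.
move=> /subnK <-; elim: (n - m)%N => // k IHk Vxy.
by apply: IHk; apply: V_cube Vxy _ _.
Qed.

(* Frink's metrization argument: cut the chain where half of its cost is
   reached; each half is a single step of the next level by induction, and so is
   the step in between. *)
Lemma chain_near n x s y : chain x s y -> cost s <= weight n -> V n x y.
Proof.
have [k] := ubnP (size s); elim: k => // k IHk in n x s y *.
case: s => [|e [|e' s]]; first by move=> _ /= ->.
  rewrite /= !costE addr0 => _ [xe <-] en.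
  apply: V_le xe; rewrite leqNgt; apply/negP => /weight_le.
  by have := weightS e.1; have := weight_gt0 e.1.+1; lra.
set s0 := [:: e, e' & s] => s0k xy s0n.
have s0_gt0 : 0 < cost s0.
  rewrite !costE; have := weight_gt0 e.1; have := weight_gt0 e'.1.
  by have := cost_ge0 s; lra.
have [||s1 [f [s2 [Es s1h hs1]]]] := @split_cost s0 (cost s0 / 2); [lra..|].
move: xy s0k; rewrite Es size_cat /= addnS => /chain_cat[z xz [zf fy]] s0k.
have s0E : cost s0 = cost s1 + (weight f.1 + cost s2) by rewrite Es !costE.
have nS := weightS n.
apply: (@V_cube _ _ z f.2).
- apply: IHk xz _; [lia | lra].
- apply: V_le zf; apply: (@ltn_weight n).
  (* Gaining a level requires a strict inequality, which holds because the chain has a step besides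
     [f]; hence the separate treatment of one-step chains. *)
  suff : 0 < cost s1 + cost s2 by lra.
  case: s1 s2 Es {s1h hs1 xz s0k fy s0E} => [|g s1] [|g' s2] //; rewrite !costE => _.
  + by have := weight_gt0 g'.1; have := cost_ge0 s2; lra.
  + by have := weight_gt0 g.1; have := cost_ge0 s1; lra.
  + have := weight_gt0 g.1; have := cost_ge0 s1; have := weight_gt0 g'.1.
    by have := cost_ge0 s2; lra.
- apply: IHk fy _; [lia | lra].
Qed.

(* Maximal runs of cost at most [weight N] are replaced by one step of level [N].
   A run followed by the next step costs more than [weight N], whence the
   factor 2. *)
Lemma coarsen_chain N x s y : chain x s y ->
  exists s', [/\ chain x s' y, all (fun e => e.1 <= N)%N s', (0 < size s')%N
    & cost s' <= 2 * cost s + weight N].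
Proof.
have [k] := ubnP (size s); elim: k => // k IHk in x s *.
move=> sk xy; have [sN|Ns] := leP (cost s) (weight N).
  (* The last run is responsible for the summand [weight N]. It is kept even when it is empty, so
     that the new chain is not. *)
  exists [:: (N, y)]; rewrite /= leqnn !costE; split=> //.
    by split=> //; exact: chain_near xy sN.
  by have := cost_ge0 s; lra.
have [s1 [e [s2 [Es s1N Ns1]]]] := split_cost (ltW (weight_gt0 N)) Ns.
move: xy sk; rewrite Es size_cat /= addnS => /chain_cat[z xz [ze ey]] sk.
have [|s' [es' s'N _ s'c]] := IHk _ _ _ ey; first by lia.
(* A step of level at most [N] costs at least [weight N] and pays for the run before it. A finer
   step is raised to level [N]; with the run it then costs two units, against an original cost of
   more than one. *)
have [eN|Ne] := leqP e.1 N.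
  exists [:: (N, z), e & s']; rewrite /= leqnn eN s'N !costE.
  split=> //; first by split=> //; exact: chain_near xz s1N.
  by have := weight_le eN; have := cost_ge0 s1; lra.
exists [:: (N, z), (N, e.2) & s']; rewrite /= leqnn s'N !costE.
split=> //; last by lra.
by split; [exact: chain_near xz s1N | split=> //; exact: V_le (ltnW Ne) ze].
Qed.

End Chains.

(** * Removal of loops from chains *)

Section ShortChains.
Variables (T : eqType) (E : nat -> T -> T -> Prop).

(** Cutting out the part between two visits to the same node leaves a subsequence, so costs do not
    grow. Distinct nodes bound the number of steps, and thereby the number of rounds of the
    search. *)
Lemma uniq_chain x s y : chain E x s y ->
  exists s', [/\ chain E x s' y, subseq s' s & uniq (x :: map snd s')].
Proof.
elim: s x => [|e s IHs] x /= => [xy|[xe /IHs[s' [ey s's s'_uniq]]]].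
  by exists [::].
have es's : subseq (e :: s') (e :: s) by rewrite /= eqxx.
have [xs'|xs'] := boolP (x \in e.2 :: map snd s'); last first.
  by exists (e :: s'); rewrite /= xs'.
suff [s1 [s2 [Es2 xy s2_uniq]]] : exists s1 s2, [/\ e :: s' = s1 ++ s2,
    chain E x s2 y & uniq (x :: map snd s2)].
  exists s2; split=> //; apply: subseq_trans es's.
  by rewrite Es2; exact: suffix_subseq.
elim: s' e x {IHs s's xe es's} ey s'_uniq xs' => [|f s' IHs] e x.
  by rewrite /= inE => -> _ /eqP->; exists [:: e], [::].
rewrite [x \in _]inE => /= -[ef fy] /andP[e_f f_uniq] /orP[/eqP->|xf].
  by exists [:: e], (f :: s'); rewrite /= e_f.
have [s1 [s2 [Es2 xy]]] := IHs f x fy f_uniq xf.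
by exists (e :: s1), s2; rewrite Es2.
Qed.

Lemma units_subseq N (s s' : seq (nat * T)) :
  subseq s' s -> units N s' <= units N s.
Proof.
rewrite /units; elim: s s' => [|e s IHs] s'; first by rewrite subseq0 => /eqP->.
case: s' => [|e' s'] /=; first by rewrite big_nil.
case: eqP => [-> /IHs|_ /IHs]; rewrite !big_cons ?leq_add2l // => le.
by apply: leq_trans le _; exact: leq_addl.
Qed.

End ShortChains.

(** * The chain pseudometric and its approximations by chains of bounded level *)

Section ChainDistance.
Local Open Scope classical_set_scope.
Local Open Scope ereal_scope.
Variables (R : realType) (T : Type) (V : nat -> T -> T -> Prop).
Implicit Types (x y z : T) (s : seq (nat * T)).

Definition chain_dist x y : \bar R :=
  ereal_inf [set (cost R s)%:E | s in [set s | chain V x s y]].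

(** The empty chain is excluded because finitely many letters never show that two points are
    equal. *)
Definition chain_dist_upto N x y : \bar R :=
  ereal_inf [set (cost R s)%:E | s in
    [set s | [/\ chain V x s y, all (fun e => e.1 <= N)%N s & (0 < size s)%N]]].

Lemma chain_dist_le_cost x s y : chain V x s y -> chain_dist x y <= (cost R s)%:E.
Proof. by move=> xy; apply: ereal_inf_lbound; exists s. Qed.

Lemma chain_dist_ge0 x y : 0 <= chain_dist x y.
Proof. by apply: le_ereal_inf_tmp => _ [s _ <-]; rewrite lee_fin cost_ge0. Qed.

Lemma chain_distxx x : chain_dist x x = 0.
Proof.
apply/eqP; rewrite eq_le chain_dist_ge0 andbT.
by apply: (@le_trans _ _ (cost R [::])%:E); [exact: chain_dist_le_cost | rewrite cost_nil].
Qed.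

Lemma chain_dist_triangle x y z : chain_dist x z <= chain_dist x y + chain_dist y z.
Proof.
have fin_inf u v : chain_dist u v != +oo -> chain_dist u v \is a fin_num.
  by move=> uv; rewrite ge0_fin_numE ?chain_dist_ge0 // ltey.
have [-> | /fin_inf xy] := eqVneq (chain_dist x y) +oo.
  by rewrite addye ?leey // gt_eqF // (lt_le_trans _ (chain_dist_ge0 _ _)).
have [-> | /fin_inf yz] := eqVneq (chain_dist y z) +oo.
  by rewrite addey ?leey // gt_eqF // (lt_le_trans _ (chain_dist_ge0 _ _)).
apply/lee_addgt0Pr => e e0; have e20 : (0 < e / 2)%R by rewrite divr_gt0.
have [_ [s xy_s <-] s_lt] := lb_ereal_inf_adherent e20 xy.
have [_ [t yz_t <-] t_lt] := lb_ereal_inf_adherent e20 yz.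
apply: (@le_trans _ _ (cost R (s ++ t))%:E).
  by apply: chain_dist_le_cost; apply/chain_cat; exists y.
rewrite cost_cat EFinD [e]splitr EFinD addeACA.
by apply: leeD; apply/ltW.
Qed.

Lemma near_chain_dist n x y : V n x y -> chain_dist x y <= (weight R n)%:E.
Proof.
move=> xy; apply: le_trans (_ : _ <= (cost R [:: (n, y)])%:E) _.
  exact: chain_dist_le_cost.
by rewrite !costE addr0.
Qed.

Lemma chain_dist_greatest (d : T -> T -> \bar R) :
  (forall x, d x x = 0) -> (forall x y z, d x z <= d x y + d y z) ->
  (forall n x y, V n x y -> d x y <= (weight R n)%:E) ->
  forall x y, d x y <= chain_dist x y.
Proof.
move=> d0 d_tri d_near x y; apply: le_ereal_inf_tmp => _ [s xy <-].
elim: s x xy => [|e s IHs] x /=; first by move->; rewrite d0 cost_nil.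
move=> [xe ey]; rewrite cost_cons EFinD.
by apply: le_trans (d_tri _ e.2 _) _; apply: leeD; [exact: d_near | exact: IHs].
Qed.

Lemma chain_dist_le_upto N x y : chain_dist x y <= chain_dist_upto N x y.
Proof. by apply: le_ereal_inf_tmp => _ [s [xy _ _] <-]; exact: chain_dist_le_cost. Qed.

Hypothesis V_refl : forall n x, V n x x.
Hypothesis V_cube :
  forall n x y z w, V n.+1 x y -> V n.+1 y z -> V n.+1 z w -> V n x w.

Lemma chain_dist_upto_cvg x y : chain_dist_upto N x y @[N --> \oo] --> chain_dist x y.
Proof.
have noninc : nonincreasing_seq (fun N => chain_dist_upto N x y).
  move=> m n mn; apply: ereal_inf_le_tmp => _ [s [xy sm s0] <-]; exists s => //.
  by split=> //; apply: sub_all sm => e em; exact: leq_trans em mn.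
have -> : chain_dist x y = ereal_inf (range (fun N => chain_dist_upto N x y)).
  apply/eqP; rewrite eq_le; apply/andP; split.
    by apply: le_ereal_inf_tmp => _ [N _ <-]; exact: chain_dist_le_upto.
  have inf_le s N : chain V x s y -> all (fun e => e.1 <= N)%N s -> (0 < size s)%N ->
      ereal_inf (range (fun N => chain_dist_upto N x y)) <= (cost R s)%:E.
    move=> xy sN s0; apply: (@le_trans _ _ (chain_dist_upto N x y)).
      by apply: ereal_inf_lbound; exists N.
    by apply: ereal_inf_lbound; exists s.
  apply: le_ereal_inf_tmp => _ [[xy | e s xy] <-].
    apply/lee_addgt0Pr => e /weight_small[n ne].
    apply: (@le_trans _ _ (cost R [:: (n, y)])%:E).
      by apply: (inf_le _ n); rewrite /= ?leqnn // xy; split=> //; exact: V_refl.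
    by rewrite !costE addr0 add0e lee_fin ltW.
  apply: (inf_le _ (\max_(i <- map fst (e :: s)) i) xy) => //.
  have : all (fun i => i <= \max_(i <- map fst (e :: s)) i)%N (map fst (e :: s)).
    by apply/allP => i i_s; exact: (@leq_bigmax_seq _ _ xpredT id).
  by rewrite all_map.
exact: ereal_nonincreasing_cvgn.
Qed.

Lemma chain_dist_near n x y : chain_dist x y < (weight R n)%:E -> V n x y.
Proof.
move=> /ereal_inf_lt[_ [s xy <-]]; rewrite lte_fin => /ltW.
exact: chain_near V_refl V_cube _ _ _ _ xy.
Qed.

Lemma chain_dist_upto_le N x y :
  chain_dist_upto N x y <= 2%:E * chain_dist x y + (weight R N)%:E.
Proof.
have up_le s : chain V x s y ->
    chain_dist_upto N x y <= (2 * cost R s + weight R N)%:E.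
  move=> /(coarsen_chain R V_refl V_cube N)[s' [xy s'N s'0 s'c]].
  apply: (@le_trans _ _ (cost R s')%:E); last by rewrite lee_fin.
  by apply: ereal_inf_lbound; exists s'.
have := chain_dist_ge0 x y; case E: (chain_dist x y) => [r| |] //= _; last first.
  by rewrite gt0_muley ?lte_fin // addye // leey.
rewrite -EFinM -EFinD; apply/lee_addgt0Pr => e e0.
have fin_xy : chain_dist x y \is a fin_num by rewrite E.
have e20 : (0 < e / 2)%R by rewrite divr_gt0.
have [_ [s /up_le xy <-] s_lt] := lb_ereal_inf_adherent e20 fin_xy.
apply: le_trans xy _; rewrite -EFinD lee_fin.
by move: s_lt; rewrite -/(chain_dist x y) E -EFinD lte_fin; lra.
Qed.

Hypothesis V_sym : forall n x y, V n x y -> V n y x.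

Lemma chain_dist_sym x y : chain_dist x y = chain_dist y x.
Proof.
suff le u v : chain_dist u v <= chain_dist v u by apply/eqP; rewrite eq_le !le.
apply: le_ereal_inf_tmp => _ [s vu <-].
suff [t uv <-] : exists2 t, chain V u t v & cost R t = cost R s.
  exact: chain_dist_le_cost.
elim: s v vu => [|e s IHs] v /= => [->|[ve /IHs[t ut tc]]]; first by exists [::].
exists (t ++ [:: (e.1, v)]); last by rewrite !costE tc addr0 addrC.
by apply/chain_cat; exists e.2 => //=; split=> //; exact: V_sym.
Qed.

End ChainDistance.

(** * Computability *)

Section Computability.

Definition oracle := bool -> nat -> nat.

(** The algorithm is written with ordinary functions on values, and its program is obtained from
    closure under the operations that occur in it. One program serves all oracles and halts on every
    input. *)
Definition computable a b (f : oracle -> value a -> value b) : Prop :=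
  exists p : prog a b, forall o v, run o p v (f o v).

Definition decidable_by_prog a (f : oracle -> value a -> bool) : Prop :=
  @computable a Nat (fun o v => nat_of_bool (f o v)).

(* The list and pair operations are restated on [value]s of explicit types, so
   that unification recovers the codes of the types. *)
Definition vfst a b (v : value (Prod a b)) : value a := v.1.
Definition vsnd a b (v : value (Prod a b)) : value b := v.2.
Definition vpair a b (v : value a) (w : value b) : value (Prod a b) := (v, w).
Definition vnil a : value (List a) := [::].
Definition vcons a (h : value a) (t : value (List a)) : value (List a) := h :: t.
Definition vfoldr a b (f : value a -> value b -> value b) (x : value b)
  (s : value (List a)) : value b := foldr f x s.
Definition viter b (n : nat) (f : nat -> value b -> value b) (x : value b) :
  value b := iteri n f x.
Definition vcat a (s t : value (List a)) : value (List a) := s ++ t.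
Definition vmap a b (f : value a -> value b) (s : value (List a)) :
  value (List b) := map f s.
Definition vflatmap a b (f : value a -> value (List b)) (s : value (List a)) :
  value (List b) := flatten (map f s).
Definition vfilter a (p : value a -> bool) (s : value (List a)) :
  value (List a) := seq.filter p s.
Definition vall a (p : value a -> bool) (s : value (List a)) : bool := all p s.
Definition vhas a (p : value a -> bool) (s : value (List a)) : bool := has p s.
Definition vsize a (s : value (List a)) : nat := size s.
Definition vbehead a (s : value (List a)) : value (List a) := behead s.
Definition vrange (n : nat) : value (List Nat) := iota 0 n.
Definition veqn (m n : nat) : bool := m == n.
Definition vif b (p : bool) (x y : value b) : value b := if p then x else y.
Definition ask (o : oracle) (j : bool) (n : nat) : nat := o j n.
Fixpoint default_value (a : ty) : value a :=
  match a with
  | Nat => 0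
  | Prod a b => (default_value a, default_value b)
  | List a => [::]
  end.
Definition vnth a (s : value (List a)) (n : nat) : value a :=
  nth (default_value a) s n.

Lemma computable_ext a b (f g : oracle -> value a -> value b) :
  (forall o v, f o v = g o v) -> computable f -> computable g.
Proof. by move=> fg [p pP]; exists p => o v; rewrite -fg. Qed.

Lemma computable_id a : computable (fun _ (v : value a) => v).
Proof. by exists (Id a). Qed.

Lemma computable_comp a b c (g : oracle -> value b -> value c)
    (f : oracle -> value a -> value b) :
  computable g -> computable f -> computable (fun o v => g o (f o v)).
Proof. by move=> [p pP] [q qP]; exists (Comp p q) => o v; exists (f o v). Qed.

Lemma computable_pair a b c (f : oracle -> value a -> value b)
    (g : oracle -> value a -> value c) :
  computable f -> computable g -> computable (fun o v => vpair (f o v) (g o v)).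
Proof. by move=> [p pP] [q qP]; exists (Pair p q). Qed.

Lemma computable_fst a b c (f : oracle -> value a -> value (Prod b c)) :
  computable f -> computable (fun o v => vfst (f o v)).
Proof.
by move=> cf; apply: (computable_comp (g := fun _ w => vfst w)) cf; exists (Fst b c).
Qed.

Lemma computable_snd a b c (f : oracle -> value a -> value (Prod b c)) :
  computable f -> computable (fun o v => vsnd (f o v)).
Proof.
by move=> cf; apply: (computable_comp (g := fun _ w => vsnd w)) cf; exists (Snd b c).
Qed.

Lemma computable_succ a (f : oracle -> value a -> nat) :
  @computable a Nat f -> @computable a Nat (fun o v => (f o v).+1).
Proof.
move=> cf; apply: (@computable_comp a Nat Nat (fun _ n => n.+1)) cf.
by exists Succ.
Qed.

Lemma computable_const a (n : nat) : @computable a Nat (fun _ _ => n).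
Proof. by elim: n => [|n IHn]; [exists (Zero a) | exact: computable_succ]. Qed.

Lemma computable_query a j (f : oracle -> value a -> nat) :
  @computable a Nat f -> @computable a Nat (fun o v => ask o j (f o v)).
Proof.
move=> cf; apply: (@computable_comp a Nat Nat (fun o n => o j n)) cf.
by exists (Query j).
Qed.

Lemma computable_iter a b (n : oracle -> value a -> nat)
    (g : oracle -> value a -> nat -> value b -> value b)
    (f : oracle -> value a -> value b) :
  @computable a Nat n ->
  @computable (Prod a (Prod Nat b)) b
    (fun o w => g o (vfst w) (vfst (vsnd w)) (vsnd (vsnd w))) ->
  computable f ->
  computable (fun o v => viter (n o v) (g o v) (f o v)).
Proof.
move=> [r rP] [q qP] [p pP].
exists (Comp (NatRec p q) (Pair (Id a) r)) => o v.
exists (v, n o v) => //=; elim: (n o v) => /= [|k IHk]; first exact: pP.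
by exists (iteri k (g o v) (f o v)) => //; exact: (qP o (v, (k, _))).
Qed.

Lemma computable_foldr a b c (s : oracle -> value a -> value (List b))
    (g : oracle -> value a -> value b -> value c -> value c)
    (f : oracle -> value a -> value c) :
  computable s ->
  @computable (Prod a (Prod b c)) c
    (fun o w => g o (vfst w) (vfst (vsnd w)) (vsnd (vsnd w))) ->
  computable f ->
  computable (fun o v => vfoldr (g o v) (f o v) (s o v)).
Proof.
move=> [r rP] [q qP] [p pP].
pose reorder := Pair (Fst a (Prod b (Prod (List b) c)))
  (Pair (Comp (Fst _ _) (Snd a (Prod b (Prod (List b) c))))
        (Comp (Snd _ _) (Comp (Snd _ _) (Snd a (Prod b (Prod (List b) c)))))).
exists (Comp (ListRec p (Comp q reorder)) (Pair (Id a) r)) => o v.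
exists (v, s o v) => //=; elim: (s o v) => /= [|h t IHt]; first exact: pP.
exists (foldr (g o v) (f o v) t) => //.
exists (v, (h, foldr (g o v) (f o v) t)); last exact: (qP o (v, (h, _))).
do 2?split=> //=; first by exists (h, (t, foldr (g o v) (f o v) t)).
by exists (t, foldr (g o v) (f o v) t) => //; exists (h, (t, foldr (g o v) (f o v) t)).
Qed.

Lemma computable_behead a b (f : oracle -> value a -> value (List b)) :
  computable f -> computable (fun o v => vbehead (f o v)).
Proof.
move=> cf; apply: (computable_comp (g := fun _ w => vbehead w)) cf.
pose tail := Comp (Fst _ _) (Comp (Snd _ _) (Snd Nat (Prod b (Prod (List b) (List b))))).
exists (Comp (ListRec (Defs.Nil Nat b) tail) (Pair (Zero _) (Id _))) => o s.
exists (0, s) => //=; elim: s => //= h t IHt.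
exists (behead t) => //; exists (t, behead t) => //.
by exists (h, (t, behead t)).
Qed.

Lemma computable_nil a b : computable (fun _ (_ : value a) => vnil b).
Proof. by exists (Defs.Nil a b). Qed.

Lemma computable_cons a b (f : oracle -> value a -> value b)
    (g : oracle -> value a -> value (List b)) :
  computable f -> computable g -> computable (fun o v => vcons (f o v) (g o v)).
Proof.
move=> [p pP] [q qP]; exists (Comp (Defs.Cons b) (Pair p q)) => o v.
by exists (f o v, g o v).
Qed.

Lemma computable_default a b : computable (fun _ (_ : value a) => default_value b).
Proof.
elim: b => [|b IHb c IHc|b IHb]; [exact: computable_const | | exact: computable_nil].
exact: (computable_pair IHb IHc).
Qed.

Lemma computable_pred a (f : oracle -> value a -> nat) :
  @computable a Nat f -> @computable a Nat (fun o v => (f o v).-1).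
Proof.
move=> cf; apply: computable_ext (_ : computable (fun o v =>
  @viter Nat (f o v) (fun k _ => k) 0)) => [ o v|]; first by case: (f o v).
apply: computable_iter cf _ (computable_const _ _).
by apply/computable_fst/computable_snd/computable_id.
Qed.

Ltac args := first [exact: computable_id | assumption
  | apply: computable_fst; args | apply: computable_snd; args
  | exact: computable_const].

(* Inside a recursion the enclosing input is the first component. *)
Lemma computable_weaken a b c (f : oracle -> value a -> value b) :
  computable f -> @computable (Prod a c) b (fun o w => f o (vfst w)).
Proof. by move=> cf; apply: computable_comp cf _; args. Qed.

Section Arithmetic.
Variables (a : ty) (f g : oracle -> value a -> nat).
Hypotheses (cf : @computable a Nat f) (cg : @computable a Nat g).

Lemma computable_add : @computable a Nat (fun o v => f o v + g o v).
Proof.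
apply: computable_ext (_ : computable (fun o v =>
  @viter Nat (g o v) (fun _ k => k.+1) (f o v))) => [ o v|].
  by elim: (g o v) => [|k /= ->]; rewrite ?addn0 ?addnS.
by apply: computable_iter cg _ cf; apply: computable_succ; args.
Qed.

Lemma computable_sub : @computable a Nat (fun o v => f o v - g o v).
Proof.
apply: computable_ext (_ : computable (fun o v =>
  @viter Nat (g o v) (fun _ k => k.-1) (f o v))) => [ o v|].
  by elim: (g o v) => [|k /= ->]; rewrite ?subn0 ?subnS.
by apply: computable_iter cg _ cf; apply: computable_pred; args.
Qed.
End Arithmetic.

Lemma computable_double a (f : oracle -> value a -> nat) :
  @computable a Nat f -> @computable a Nat (fun o v => (f o v).*2).
Proof.
move=> cf; apply: computable_ext (computable_add cf cf) => o v.
by rewrite addnn.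
Qed.

Lemma computable_mul a (f g : oracle -> value a -> nat) :
  @computable a Nat f -> @computable a Nat g ->
  @computable a Nat (fun o v => f o v * g o v).
Proof.
move=> cf cg; apply: computable_ext (_ : computable (fun o v =>
  @viter Nat (g o v) (fun _ k => f o v + k) 0)) => [ o v|].
  by elim: (g o v) => [|k /= ->]; rewrite ?muln0 ?mulnS.
apply: computable_iter cg _ (computable_const _ _).
by apply: computable_add; [exact: computable_weaken | args].
Qed.

Lemma computable_exp a (f g : oracle -> value a -> nat) :
  @computable a Nat f -> @computable a Nat g ->
  @computable a Nat (fun o v => f o v ^ g o v).
Proof.
move=> cf cg; apply: computable_ext (_ : computable (fun o v =>
  @viter Nat (g o v) (fun _ k => f o v * k) 1)) => [ o v|].
  by elim: (g o v) => [|k /= ->]; rewrite ?expn0 ?expnS.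
apply: computable_iter cg _ (computable_const _ _).
by apply: computable_mul; [exact: computable_weaken | args].
Qed.

Lemma computable_min a (f g : oracle -> value a -> nat) :
  @computable a Nat f -> @computable a Nat g ->
  @computable a Nat (fun o v => minn (f o v) (g o v)).
Proof.
move=> cf cg; apply: computable_ext (_ : @computable a Nat (fun o v =>
  f o v - (f o v - g o v))) => [ o v|]; first by rewrite minnE.
by do 2?apply: computable_sub.
Qed.

Lemma decidable_eqn a (f g : oracle -> value a -> nat) :
  @computable a Nat f -> @computable a Nat g ->
  decidable_by_prog (fun o v => veqn (f o v) (g o v)).
Proof.
move=> cf cg; apply: computable_ext (_ : @computable a Nat (fun o v =>
    1 - ((f o v - g o v) + (g o v - f o v)))) => [ o v|].
  by rewrite /veqn; case: eqVneq; lia.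
apply: computable_sub; first exact: computable_const.
by apply: computable_add; apply: computable_sub.
Qed.

Lemma decidable_ltn a (f g : oracle -> value a -> nat) :
  @computable a Nat f -> @computable a Nat g ->
  decidable_by_prog (fun o v => f o v < g o v).
Proof.
move=> cf cg; apply: computable_ext (_ : @computable a Nat (fun o v =>
    1 - ((f o v).+1 - g o v))) => [ o v|]; first by lia.
apply: computable_sub; first exact: computable_const.
by apply: computable_sub => //; exact: computable_succ.
Qed.

Lemma computable_if a b (p : oracle -> value a -> bool)
    (f g : oracle -> value a -> value b) :
  decidable_by_prog p -> computable f -> computable g ->
  computable (fun o v => vif (p o v) (f o v) (g o v)).
Proof.
move=> cp cf cg; apply: computable_ext (_ : computable (fun o v =>
    viter (p o v) (fun _ _ => f o v) (g o v))) => [ o v|].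
  by rewrite /viter /vif; case: (p o v).
by apply: computable_iter cp _ cg; exact: computable_weaken.
Qed.

Lemma decidable_and a (p q : oracle -> value a -> bool) :
  decidable_by_prog p -> decidable_by_prog q ->
  decidable_by_prog (fun o v => p o v && q o v).
Proof.
move=> cp cq; apply: computable_ext (computable_mul cp cq) => o v.
by rewrite mulnb.
Qed.

Lemma decidable_impl a (p q : oracle -> value a -> bool) :
  decidable_by_prog p -> decidable_by_prog q ->
  decidable_by_prog (fun o v => p o v ==> q o v).
Proof.
move=> cp cq; apply: computable_ext
  (@computable_if a Nat p _ _ cp cq (computable_const a 1)) => o v.
by case: (p o v).
Qed.

Lemma decidable_odd a (f : oracle -> value a -> nat) :
  @computable a Nat f -> decidable_by_prog (fun o v => odd (f o v)).
Proof.
move=> cf; apply: computable_ext (_ : computable (fun o v =>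
    @viter Nat (f o v) (fun _ k => 1 - k) 0)) => [ o v|].
  by elim: (f o v) => //= k ->; case: (odd k).
apply: computable_iter cf _ (computable_const _ _).
by apply: computable_sub; args.
Qed.

Lemma computable_cat a b (f g : oracle -> value a -> value (List b)) :
  computable f -> computable g -> computable (fun o v => vcat (f o v) (g o v)).
Proof.
move=> cf cg; apply: computable_ext (_ : computable (fun o v =>
    vfoldr (@vcons b) (g o v) (f o v))) => [ o v|].
  by rewrite /vcat; elim: (f o v) => //= h t ->.
by apply: computable_foldr cf _ cg; apply: computable_cons; args.
Qed.

Section HigherOrder.
Variables (a b : ty) (s : oracle -> value a -> value (List b)).
Hypothesis cs : computable s.

Lemma computable_flatmap c (f : oracle -> value a -> value b -> value (List c)) :
  @computable (Prod a b) (List c) (fun o w => f o (vfst w) (vsnd w)) ->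
  computable (fun o v => vflatmap (f o v) (s o v)).
Proof.
move=> cf; apply: computable_ext (_ : computable (fun o v =>
    vfoldr (fun h t => vcat (f o v h) t) (vnil c) (s o v))) => [ o v|].
  by rewrite /vflatmap; elim: (s o v) => //= h t ->.
apply: computable_foldr cs _ (computable_nil _ _); apply: computable_cat; last by args.
by apply: (@computable_comp _ (Prod a b) _ (fun o w => f o (vfst w) (vsnd w))
  (fun o w => vpair (vfst w) (vfst (vsnd w)))) cf _; apply: computable_pair; args.
Qed.

Lemma computable_map c (f : oracle -> value a -> value b -> value c) :
  @computable (Prod a b) c (fun o w => f o (vfst w) (vsnd w)) ->
  computable (fun o v => vmap (f o v) (s o v)).
Proof.
move=> cf; apply: computable_ext (computable_flatmap
  (f := fun o v x => vcons (f o v x) (vnil c)) _) => [ o v|].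
  by rewrite /vflatmap /vmap; elim: (s o v) => //= h t ->.
by apply: computable_cons cf (computable_nil _ _).
Qed.

Variable p : oracle -> value a -> value b -> bool.
Hypothesis cp : @decidable_by_prog (Prod a b) (fun o w => p o (vfst w) (vsnd w)).

Lemma computable_filter : computable (fun o v => vfilter (p o v) (s o v)).
Proof.
apply: computable_ext (computable_flatmap
  (f := fun o v x => vif (p o v x) (vcons x (vnil b)) (vnil b)) _) => [ o v|].
  by rewrite /vflatmap /vfilter /vif; elim: (s o v) => //= h t ->; case: ifP.
by apply: computable_if cp _ (computable_nil _ _);
  apply: computable_cons (computable_nil _ _); args.
Qed.

Lemma computable_size : @computable a Nat (fun o v => vsize (s o v)).
Proof.
apply: computable_ext (_ : computable (fun o v =>
    @vfoldr b Nat (fun _ n => n.+1) 0 (s o v))) => [ o v|].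
  by rewrite /vsize; elim: (s o v) => //= h t ->.
by apply: computable_foldr cs _ (computable_const _ _); apply: computable_succ; args.
Qed.
End HigherOrder.

Lemma decidable_has a b (s : oracle -> value a -> value (List b))
    (p : oracle -> value a -> value b -> bool) :
  computable s ->
  @decidable_by_prog (Prod a b) (fun o w => p o (vfst w) (vsnd w)) ->
  decidable_by_prog (fun o v => vhas (p o v) (s o v)).
Proof.
move=> cs cp; apply: computable_ext (_ : @computable a Nat (fun o v =>
    0 < vsize (vfilter (p o v) (s o v)))) => [ o v|].
  by rewrite /vhas has_count -size_filter.
apply: decidable_ltn; first exact: computable_const.
exact: computable_size (computable_filter cs cp).
Qed.

Lemma decidable_all a b (s : oracle -> value a -> value (List b))
    (p : oracle -> value a -> value b -> bool) :
  computable s ->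
  @decidable_by_prog (Prod a b) (fun o w => p o (vfst w) (vsnd w)) ->
  decidable_by_prog (fun o v => vall (p o v) (s o v)).
Proof.
move=> cs cp; apply: computable_ext (_ : decidable_by_prog (fun o v =>
    veqn (vsize (vfilter (p o v) (s o v))) (vsize (s o v)))) => [ o v|].
  by rewrite /vall all_count -size_filter.
apply: decidable_eqn; last exact: computable_size.
exact: computable_size (computable_filter cs cp).
Qed.

Lemma computable_range a (n : oracle -> value a -> nat) :
  @computable a Nat n -> computable (fun o v => vrange (n o v)).
Proof.
move=> cn; apply: computable_ext (_ : computable (fun o v =>
    @viter (List Nat) (n o v) (fun k s => vcat s (@vcons Nat k (vnil Nat))) (vnil Nat)))
    => [ o v|].
  by rewrite /vrange; elim: (n o v) => // k IHk; rewrite -addn1 iotaD -IHk addn1.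
apply: computable_iter cn _ (computable_nil _ _).
by apply: computable_cat; [args | apply: computable_cons (computable_nil _ _); args].
Qed.

Lemma computable_nth a b (s : oracle -> value a -> value (List b))
    (n : oracle -> value a -> nat) :
  computable s -> @computable a Nat n ->
  computable (fun o v => vnth (s o v) (n o v)).
Proof.
move=> cs cn; apply: computable_ext (_ : computable (fun o v =>
    vfoldr (fun h (_ : value b) => h) (default_value b)
      (viter (n o v) (fun _ s => vbehead s) (s o v)))) => [ o v|].
  rewrite /vnth -[n o v in RHS]addn0 -nth_drop.
  suff -> : viter (n o v) (fun _ => @vbehead b) (s o v) = drop (n o v) (s o v).
    by case: drop.
  elim: (n o v) => [|k /= ->]; first by rewrite drop0.
  by rewrite /vbehead -drop1 drop_drop add1n.
apply: computable_foldr _ _ (computable_default _ _); last by args.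
by apply: computable_iter cn _ cs; apply: computable_behead; args.
Qed.

End Computability.

(** * The algorithm *)

Lemma computable_width M a (f : oracle -> value a -> nat) :
  @computable a Nat f -> @computable a Nat (fun o v => width M (f o v)).
Proof.
case: M => cf; apply: computable_succ => //; exact: computable_double.
Qed.

Lemma computable_succ_code M a (f : oracle -> value a -> nat) :
  @computable a Nat f -> @computable a Nat (fun o v => succ_code M (f o v)).
Proof.
case: M => cf; first exact: computable_succ.
apply: (@computable_if a Nat).
- exact: decidable_odd.
- by apply: computable_sub cf _; exact: computable_const.
- by do 2!apply: computable_succ.
Qed.

Ltac computable_step :=
  cbv beta;
  lazymatch goal with
  | |- decidable_by_prog (fun o v => (@?x o v) && (@?y o v)) => refine (decidable_and _ _)
  | |- decidable_by_prog (fun o v => (@?x o v) ==> (@?y o v)) => refine (decidable_impl _ _)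
  | |- decidable_by_prog (fun o v => odd (@?x o v)) => refine (decidable_odd _)
  | |- decidable_by_prog (fun o v => veqn (@?x o v) (@?y o v)) => refine (decidable_eqn _ _)
  | |- decidable_by_prog (fun o v => (@?x o v) < (@?y o v)) => refine (decidable_ltn _ _)
  | |- decidable_by_prog (fun o v => vhas (@?x o v) (@?y o v)) => refine (decidable_has _ _)
  | |- decidable_by_prog (fun o v => vall (@?x o v) (@?y o v)) => refine (decidable_all _ _)
  | |- computable (fun o v => v) => refine (computable_id _)
  | |- computable (fun o v => vfst (@?x o v)) => refine (computable_fst _)
  | |- computable (fun o v => vsnd (@?x o v)) => refine (computable_snd _)
  | |- computable (fun o v => vpair (@?x o v) (@?y o v)) => refine (computable_pair _ _)
  | |- computable (fun o v => vcons (@?x o v) (@?y o v)) => refine (computable_cons _ _)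
  | |- computable (fun o v => vnil _) => refine (computable_nil _ _)
  | |- computable (fun o v => vcat (@?x o v) (@?y o v)) => refine (computable_cat _ _)
  | |- computable (fun o v => vmap (@?x o v) (@?y o v)) => refine (computable_map _ _)
  | |- computable (fun o v => vflatmap (@?x o v) (@?y o v)) => refine (computable_flatmap _ _)
  | |- computable (fun o v => vfilter (@?x o v) (@?y o v)) => refine (computable_filter _ _)
  | |- computable (fun o v => vfoldr (@?z o v) (@?x o v) (@?y o v)) =>
      refine (computable_foldr _ _ _)
  | |- computable (fun o v => viter (@?z o v) (@?x o v) (@?y o v)) => refine (computable_iter _ _ _)
  | |- computable (fun o v => vsize (@?x o v)) => refine (computable_size _)
  | |- computable (fun o v => vrange (@?x o v)) => refine (computable_range _)
  | |- computable (fun o v => vnth (@?x o v) (@?y o v)) => refine (computable_nth _ _)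
  | |- computable (fun o v => vif (@?z o v) (@?x o v) (@?y o v)) => refine (computable_if _ _ _)
  | |- computable (fun o v => minn (@?x o v) (@?y o v)) => refine (computable_min _ _)
  | |- computable (fun o v => (@?x o v) ^ (@?y o v)) => refine (computable_exp _ _)
  | |- computable (fun o v => (@?x o v) * (@?y o v)) => refine (computable_mul _ _)
  | |- computable (fun o v => (@?x o v) - (@?y o v)) => refine (computable_sub _ _)
  | |- computable (fun o v => (@?x o v) + (@?y o v)) => refine (computable_add _ _)
  | |- computable (fun o v => (@?x o v).*2) => refine (computable_double _)
  | |- computable (fun o v => (@?x o v).+1) => refine (computable_succ _)
  | |- computable (fun o v => ask o ?j (@?y o v)) => refine (computable_query _ _)
  | |- computable (fun o v => (@?x o v).-1) => refine (computable_pred _)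
  | |- computable (fun o v => width ?M (@?x o v)) => refine (computable_width M _)
  | |- computable (fun o v => succ_code ?M (@?x o v)) => refine (computable_succ_code M _)
  | |- _ => exact (computable_const _ _)
  end.

Ltac computable_tac := repeat computable_step.

Definition Edge1 : ty := Prod (Prod Nat Nat) Nat.
Definition Edge2 : ty := Prod (Prod Nat (Prod Nat Nat)) Nat.
Definition State3 : ty := Prod Nat (Prod Nat Nat).
Definition Edge3 : ty := Prod (Prod State3 (Prod Nat Nat)) State3.

Definition triple (q1 q2 q3 : nat) : value State3 :=
  @vpair Nat (Prod Nat Nat) q1 (@vpair Nat Nat q2 q3).

(** The product automaton of $A$, $A$ and $B$, which reads the pairs in $Z\cap Y^2$. Both copies of
    $A$ are included because only $Z\cap Y^2$, and not $Z$, is assumed to be an equivalence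
    relation. *)
Definition fibre (A : value Edges1) (B : value Edges2) : value (List Edge3) :=
  vflatmap (fun e1 : value Edge1 => vflatmap (fun e2 : value Edge1 =>
    vmap (fun e3 : value Edge2 =>
      vpair
        (vpair (triple (vfst (vfst e1)) (vfst (vfst e2)) (vfst (vfst e3)))
          (vsnd (vfst e3)))
        (triple (vsnd e1) (vsnd e2) (vsnd e3)))
    (vfilter (fun e3 : value Edge2 => veqn (vfst (vsnd (vfst e3))) (vsnd (vfst e1))
        && veqn (vsnd (vsnd (vfst e3))) (vsnd (vfst e2))) B)) A) A.

Section Algorithm.
Variable M : time.

Definition sequences (P : value (List Edge3)) (l : nat) : value (List (List Edge3)) :=
  viter l (fun _ s => vflatmap (fun e : value Edge3 =>
      vmap (fun t : value (List Edge3) => vcons e t) s) P)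
    (vcons (vnil Edge3) (vnil (List Edge3))).

Definition same_state (q q' : value State3) : bool :=
  veqn (vfst q) (vfst q') &&
  (veqn (vfst (vsnd q)) (vfst (vsnd q')) && veqn (vsnd (vsnd q)) (vsnd (vsnd q'))).

Definition paths (P : value (List Edge3)) (l : nat) : value (List (List Edge3)) :=
  vfilter (fun t : value (List Edge3) => vall (fun n : value Nat =>
      (succ_code M n < l) ==>
      same_state (vsnd (vnth t n)) (vfst (vfst (vnth t (succ_code M n)))))
    (vrange l)) (sequences P l).

(** The constant $c$. The cube counts the triples of edges in [nearby_cube]; the successor makes $c$
    positive even for an empty list, so that the windows $cn$ exhaust the indices. *)
Definition margin (P : value (List Edge3)) : nat := (vsize P ^ 3).+1.

Definition near_code (P : value (List Edge3)) (m : nat)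
    (u v : value (List Nat)) : bool :=
  vhas (fun t : value (List Edge3) => vall (fun n : value Nat =>
      veqn (vfst (vsnd (vfst (vnth t n)))) (vnth u n) &&
      veqn (vsnd (vsnd (vfst (vnth t n)))) (vnth v n))
    (vrange (width M m))) (paths P (width M (m + margin P))).

Definition words (P : value (List Edge3)) (m : nat) : value (List (List Nat)) :=
  vmap (fun t : value (List Edge3) =>
      @vmap Nat Nat (fun n : value Nat => vfst (vsnd (vfst (vnth t n))))
        (vrange (width M m)))
    (paths P (width M (m + margin P))).

(** Chains grow at their front, starting from the word of the second point, in accordance with the
    recursion that defines [chain]. *)
Definition extend (P : value (List Edge3)) (N : nat)
    (s : value (List (Prod (List Nat) Nat))) : value (List (Prod (List Nat) Nat)) :=
  vflatmap (fun us : value (Prod (List Nat) Nat) =>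
    vflatmap (fun n : value Nat => vflatmap (fun u : value (List Nat) =>
        vif (near_code P (margin P * n) u (vfst us))
          (vcons (@vpair (List Nat) Nat u (vsnd us + 2 ^ (N - n)))
            (vnil (Prod (List Nat) Nat)))
          (vnil (Prod (List Nat) Nat)))
      (words P (margin P * N)))
    (vrange N.+1)) s.

(* Lists the pairs (u, s) such that a chain of at most k steps of levels at most
   N and of total cost s, in units of 2^(1-N), leads from u to v. *)
Definition reachable (P : value (List Edge3)) (N k : nat) (v : value (List Nat)) :
    value (List (Prod (List Nat) Nat)) :=
  viter k (fun _ (s : value (List (Prod (List Nat) Nat))) => vcat s (extend P N s))
    (vcons (@vpair (List Nat) Nat v 0) (vnil (Prod (List Nat) Nat))).

(* The minimum of [s] shifted by one, so that 0 stands for the value +oo that the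
   minimum of the empty list has. *)
Definition least (s : value (List Nat)) : nat :=
  @vfoldr Nat Nat (fun k l => @vif Nat (veqn l 0) k.+1 (minn k.+1 l)) 0 s.

(* A cost of 0 is rounded up to one unit: points with the same word are joined by
   the empty chain of words, but by no empty chain of points. *)
Definition least_cost (o : oracle) (P : value (List Edge3)) (N : nat) : nat :=
  least (@vmap (Prod (List Nat) Nat) Nat (fun us => vsnd us + (1 - vsnd us))
    (vfilter (fun us : value (Prod (List Nat) Nat) =>
        vall (fun n : value Nat => veqn (vnth (vfst us) n) (ask o false n))
          (vrange (width M (margin P * N))))
      (reachable P N (vsize (words P (margin P * N)))
        (@vmap Nat Nat (fun n : value Nat => ask o true n)
          (vrange (width M (margin P * N))))))).

(** [w] is shifted by one as in [least], and one unit is [2 / 2 ^ N]. *)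
Definition upper_bound (w N : nat) : value Rational :=
  @vif Rational (veqn w 0) (@vpair Nat Nat 1 0) (@vpair Nat Nat (2 * w.-1) (2 ^ N)).

(** For a minimal cost of [k = w.-1] units this is half of [k.-1] units, that is [k.-1 / 2 ^ N]. *)
Definition lower_bound (w N : nat) : value Rational :=
  @vif Rational (veqn w 0) (@vpair Nat Nat 1 0) (@vpair Nat Nat w.-2 (2 ^ N)).

Lemma computable_fibre :
  @computable (Prod Edges1 Edges2) (List Edge3) (fun _ w => fibre (vfst w) (vsnd w)).
Proof. by rewrite /fibre /triple; computable_tac. Qed.

Lemma computable_least_cost : @computable (Prod (List Edge3) Nat) Nat
  (fun o w => least_cost o (vfst w) (vsnd w)).
Proof.
rewrite /least_cost /least /reachable /extend /words /near_code /margin /paths /same_state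
  /sequences.
by computable_tac.
Qed.

Lemma computable_least_cost_fibre a (AB : oracle -> value a -> value (Prod Edges1 Edges2))
    (N : oracle -> value a -> nat) :
  computable AB -> @computable a Nat N ->
  @computable a Nat (fun o v =>
    least_cost o (fibre (vfst (AB o v)) (vsnd (AB o v))) (N o v)).
Proof.
move=> cAB cN; apply: (computable_comp computable_least_cost
  (f := fun o v => @vpair (List Edge3) Nat
    (fibre (vfst (AB o v)) (vsnd (AB o v))) (N o v))).
by apply: computable_pair cN; exact: computable_comp computable_fibre cAB.
Qed.

Lemma computable_upper_bound :
  @computable (Prod (Prod Edges1 Edges2) Nat) Rational (fun o v =>
    upper_bound (least_cost o (fibre (vfst (vfst v)) (vsnd (vfst v))) (vsnd v))
      (vsnd v)).
Proof.
have c_bound : @computable (Prod Nat Nat) Rational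
    (fun _ w => upper_bound (vfst w) (vsnd w)).
  by rewrite /upper_bound; computable_tac.
pose costs (o : oracle) (v : value (Prod (Prod Edges1 Edges2) Nat)) :=
  @vpair Nat Nat
    (least_cost o (fibre (vfst (vfst v)) (vsnd (vfst v))) (vsnd v)) (vsnd v).
have c_costs : computable costs.
  apply: (@computable_pair _ Nat Nat); last by computable_tac.
  by apply: computable_least_cost_fibre; computable_tac.
by refine (computable_ext _ (computable_comp c_bound c_costs)).
Qed.

Lemma computable_lower_bound :
  @computable (Prod (Prod Edges1 Edges2) Rational) Rational (fun o v =>
    lower_bound (least_cost o (fibre (vfst (vfst v)) (vsnd (vfst v)))
      (@vsnd Nat Nat (vsnd v)).+1) (@vsnd Nat Nat (vsnd v)).+1).
Proof.
have c_bound : @computable (Prod Nat Nat) Rational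
    (fun _ w => lower_bound (vfst w) (vsnd w)).
  by rewrite /lower_bound; computable_tac.
pose costs (o : oracle) (v : value (Prod (Prod Edges1 Edges2) Rational)) :=
  @vpair Nat Nat
    (least_cost o (fibre (vfst (vfst v)) (vsnd (vfst v)))
      (@vsnd Nat Nat (vsnd v)).+1) (@vsnd Nat Nat (vsnd v)).+1.
have c_costs : computable costs.
  apply: (@computable_pair _ Nat Nat); last by computable_tac.
  by apply: computable_least_cost_fibre; computable_tac.
by refine (computable_ext _ (computable_comp c_bound c_costs)).
Qed.

End Algorithm.

(** * Correctness of the algorithm *)

Section Correctness.
Variable M : time.
Local Notation St := (nat * (nat * nat))%type.
Implicit Types (A : value Edges1) (B : value Edges2) (P : value (List Edge3)).
Implicit Types (x y z : nat -> nat).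

Lemma mem_fibre A B (q1 q2 q3 l1 l2 r1 r2 r3 : nat) :
  ((((q1, (q2, q3)), (l1, l2)), (r1, (r2, r3))) : St * (nat * nat) * St)
    \in (fibre A B : seq (St * (nat * nat) * St)) =
  [&& ((q1, l1, r1) : nat * nat * nat) \in (A : seq (nat * nat * nat)),
      ((q2, l2, r2) : nat * nat * nat) \in (A : seq (nat * nat * nat))
    & ((q3, (l1, l2), r3) : nat * (nat * nat) * nat) \in (B : seq (nat * (nat * nat) * nat))].
Proof.
apply/flatten_mapP/and3P => [[[[a l] a'] aA /flatten_mapP[[[b l'] b'] bA]]|[e1A e2A e3B]].
  move=> /mapP[[[g [m m']] g']].
  rewrite mem_filter /veqn /vfst /vsnd /= => /andP[/andP[/eqP-> /eqP->] gB].
  by case=> -> -> -> -> -> -> -> ->.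
exists (q1, l1, r1) => //; apply/flatten_mapP; exists (q2, l2, r2) => //.
apply/mapP; exists (q3, (l1, l2), r3) => //.
by rewrite mem_filter /veqn /vfst /vsnd /= !eqxx.
Qed.

Lemma linked_fibre A B x y :
  linked M (fibre A B : seq (St * (nat * nat) * St)) x y <->
  [/\ exists q : nat -> nat, forall n,
        ((q n, x n, q (succ_code M n)) : nat * nat * nat) \in (A : seq _),
      exists q : nat -> nat, forall n,
        ((q n, y n, q (succ_code M n)) : nat * nat * nat) \in (A : seq _)
    & exists q : nat -> nat, forall n,
        ((q n, (x n, y n), q (succ_code M n)) : nat * (nat * nat) * nat)
          \in (B : seq _)].
Proof.
split=> [[q qP]|[[q1 q1P] [q2 q2P] [q3 q3P]]].
  have qE n : [&& (((q n).1, x n, (q (succ_code M n)).1) : nat * nat * nat)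
        \in (A : seq (nat * nat * nat)),
      (((q n).2.1, y n, (q (succ_code M n)).2.1) : nat * nat * nat)
        \in (A : seq (nat * nat * nat))
    & (((q n).2.2, (x n, y n), (q (succ_code M n)).2.2) : nat * (nat * nat) * nat)
        \in (B : seq (nat * (nat * nat) * nat))].
    have := qP n; case: (q n) => a [b c]; case: (q (succ_code M n)) => a' [b' c'].
    by rewrite mem_fibre.
  split.
  - by exists (fun n => (q n).1) => n; have /and3P[] := qE n.
  - by exists (fun n => (q n).2.1) => n; have /and3P[] := qE n.
  - by exists (fun n => (q n).2.2) => n; have /and3P[] := qE n.
exists (fun n => (q1 n, (q2 n, q3 n))) => n.
by rewrite mem_fibre q1P q2P q3P.
Qed.

Lemma mem_sequences P l (t : seq (St * (nat * nat) * St)) :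
  reflect (size t = l /\ {subset t <= (P : seq (St * (nat * nat) * St))})
    (t \in (sequences P l : seq (seq (St * (nat * nat) * St)))).
Proof.
apply: (iffP idP).
  elim: l t => [|l IHl] t; first by rewrite inE => /eqP->.
  move=> /flatten_mapP[e eP /mapP[t' /IHl[<- t'P] ->]]; split=> // e'.
  by rewrite inE => /orP[/eqP->|/t'P].
elim: l t => [|l IHl] t [].
  by move/size0nil => -> _; rewrite inE.
case: t => // e t [tl] tP; apply/flatten_mapP; exists e.
  by apply: tP; rewrite mem_head.
by apply/map_f/IHl; split=> // e' e't; apply: tP; rewrite inE e't orbT.
Qed.

Lemma same_stateE (q q' : St) : same_state q q' = (q == q').
Proof. by case: q q' => [a [b c]] [a' [b' c']]. Qed.

Lemma mem_paths P l (t : seq (St * (nat * nat) * St)) :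
  reflect (finite_path M (P : seq (St * (nat * nat) * St)) l t)
    (t \in (paths M P l : seq (seq (St * (nat * nat) * St)))).
Proof.
rewrite mem_filter; apply: (iffP andP) => [[/allP adj /mem_sequences[tl tP]]|].
  split=> // d n nl Snl.
  have := adj n; rewrite mem_iota nl => /(_ isT)/implyP/(_ Snl).
  rewrite same_stateE => /eqP.
  by rewrite /vnth !(set_nth_default d) ?tl.
move=> [tl tP adj]; split; last by apply/mem_sequences.
apply/allP => n; rewrite mem_iota => /= nl.
by apply/implyP => Snl; rewrite same_stateE; apply/eqP/adj.
Qed.

Local Notation nearby P := (nearby M (P : seq (St * (nat * nat) * St))).
Local Notation linked P := (linked M (P : seq (St * (nat * nat) * St))).

Lemma size_le_margin P : size (P : seq (St * (nat * nat) * St)) <= margin P.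
Proof.
rewrite /margin /vsize; case: (size _) => // n.
by rewrite ltnW // ltnS -[in leqLHS](expn1 n.+1) leq_pexp2l.
Qed.

Lemma near_codeP P m (u v : seq nat) :
  reflect (nearby P m (nth 0 u) (nth 0 v)) (near_code M P m u v).
Proof.
apply: (iffP hasP) => [[t /mem_paths tP /allP lab]|].
  apply/(nearby_finite _ _ (default_value Edge3 : St * (nat * nat) * St) _ _
    (size_le_margin P)).
  exists t; split=> // n nm; have := lab n; rewrite mem_iota nm => /(_ isT).
  rewrite /veqn /vfst /vsnd /vnth; case: (nth _ t n) => [[? [l1 l2]] ?] /=.
  by move=> /andP[/eqP-> /eqP->].
move=> /(nearby_finite _ _ (default_value Edge3 : St * (nat * nat) * St) _ _
  (size_le_margin P))[t [tP lab]].
exists t; first by apply/mem_paths.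
apply/allP => n; rewrite mem_iota => /= nm.
by rewrite /veqn /vfst /vsnd /vnth lab //= !eqxx.
Qed.

Definition prefix m x : seq nat := mkseq x (width M m).

Lemma agree_prefix m m' x : m' <= m -> agree M m' (nth 0 (prefix m x)) x.
Proof.
by move=> m'm n nm'; rewrite nth_mkseq // (leq_trans nm') // width_mono.
Qed.

Lemma near_code_prefix P m m' x y : m' <= m ->
  near_code M P m' (prefix m x) (prefix m y) <-> nearby P m' x y.
Proof.
move=> m'm; split=> [/near_codeP|] xy.
  by apply: nearby_agree xy; exact: agree_prefix.
by apply/near_codeP; apply: nearby_agree xy; apply: agreeC; exact: agree_prefix.
Qed.

Variables (P : value (List Edge3)).
Hypothesis linked_refl : forall x y, linked P x y -> linked P x x.

(** A path that is longer than the window by the margin extends, by pumping, to a linked pair;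
    reflexivity then links the first component to itself. *)
Lemma mem_words m (u : seq nat) :
  u \in (words M P m : seq (seq nat)) <-> exists2 x, linked P x x & u = prefix m x.
Proof.
pose d := default_value Edge3 : St * (nat * nat) * St.
split=> [/mapP[t /mem_paths tP ->]|[x xx ->]].
  have [|x [y [xy xt _]]] := (nearby_finite M m d (fun n => (nth d t n).1.2.1)
      (fun n => (nth d t n).1.2.2) (size_le_margin P)).2.
    by exists t; split=> // n _; case: (nth d t n) => [[? []]].
  exists x; first exact: linked_refl xy.
  apply/eq_in_map => n; rewrite mem_iota => /= nm.
  by rewrite xt.
have /(nearby_finite _ _ d _ _ (size_le_margin P))[t [tP lab]] := linked_nearby m xx.
apply/mapP; exists t; first by apply/mem_paths.
apply/eq_in_map => n; rewrite mem_iota => /= nm.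
by rewrite /vfst /vsnd /vnth lab.
Qed.

(** The membership of [u] in [words] is what allows the nodes of a chain of words to be lifted to
    points. *)
Definition step N (n : nat) (u v : seq nat) : Prop :=
  [/\ n <= N, near_code M P (margin P * n) u v
    & u \in (words M P (margin P * N) : seq (seq nat))].

Lemma mem_reachable N k (v : seq nat) (us : seq nat * nat) :
  us \in (reachable M P N k v : seq (seq nat * nat)) <->
  exists s, [/\ chain (step N) us.1 s v, size s <= k & units N s = us.2].
Proof.
elim: k us => [|k IHk] us.
  rewrite inE; split=> [/eqP->|[s [uv s0 us2]]].
    by exists [::]; rewrite /units big_nil.
  move: s0 uv us2; rewrite leqn0 => /nilP-> /=; rewrite /units big_nil.
  by case: us => u m /= -> <-.
rewrite -[reachable M P N k.+1 v]/(vcat (reachable M P N k v)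
  (extend M P N (reachable M P N k v))) mem_cat; split.
  move=> /orP[/IHk[s [uv sk us2]]|]; first by exists s; split=> //; exact: leqW.
  move=> /flatten_mapP[[w m] /IHk[s [/= wv sk wm]] /flatten_mapP[n]].
  rewrite mem_iota ltnS => /= nN /flatten_mapP[u u_in]; rewrite /vif.
  case: ifP => // uw; rewrite inE => /eqP->.
  exists ((n, w) :: s); split=> //=.
  by rewrite -wm /units big_cons addnC.
move=> [s [uv sk us2]]; have [sk'|ks] := leqP (size s) k.
  by apply/orP; left; apply/IHk; exists s.
apply/orP; right; case: s uv sk us2 ks => // [[n w] s] /= [[nN uw u_in] wv] sk us2 _.
apply/flatten_mapP; exists (w, units N s); first by apply/IHk; exists s.
apply/flatten_mapP; exists n; first by rewrite mem_iota.
apply/flatten_mapP; exists us.1 => //; rewrite /vif /vfst uw.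
by case: us us2 {uw u_in} => u m /= <-; rewrite /units big_cons inE addnC.
Qed.

Lemma leastP (s : seq nat) :
  match least s with
  | 0 => s = [::]
  | k.+1 => k \in s /\ forall l, l \in s -> k <= l
  end.
Proof.
elim: s => //= h t IHt; rewrite /vif /veqn.
move: IHt; rewrite -/(least t); case: (least t) => [->|k [kt t_ge]] /=.
  by rewrite mem_head; split=> // l; rewrite inE => /eqP->.
rewrite minnSS; split.
  by rewrite inE /minn; case: ifP => _; rewrite ?eqxx // kt orbT.
move=> l; rewrite inE => /orP[/eqP->|/t_ge]; first exact: geq_minl.
by apply: leq_trans; exact: geq_minr.
Qed.

Variables (T : Type) (code : T -> nat -> nat).
Hypothesis code_range : forall x, linked P x x <-> exists t, code t = x.

Local Notation V := (fun n s t => nearby P (margin P * n) (code s) (code t)).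

(** Each intermediate word is the prefix of some point, and any such point will do, because a step
    of level at most [N] depends only on the window [margin P * N]. The empty chain does not lift:
    it says only that two prefixes are equal. *)
Lemma step_chain N s (u : seq nat) (t : T) (a : T) :
  chain (step N) u s (prefix (margin P * N) (code t)) ->
  u = prefix (margin P * N) (code a) -> 0 < size s ->
  exists s', [/\ chain V a s' t, all (fun e => e.1 <= N) s', 0 < size s'
    & units N s' = units N s].
Proof.
have V_prefix n b c : n <= N -> near_code M P (margin P * n)
    (prefix (margin P * N) (code b)) (prefix (margin P * N) (code c)) ->
    V n b c.
  by move=> nN /near_code_prefix; apply; rewrite leq_mul2l nN orbT.
elim: s u a => // [[n w] [|e s]] IHs u a.
  move=> /= [[nN uw _] wt] ua _; have at_ : V n a t.
    by apply: V_prefix => //; rewrite -ua -wt.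
  by exists [:: (n, t)]; rewrite /= nN /units !big_cons !big_nil.
move=> [[/= nN uw _] wt] ua _.
have [_ _ /mem_words[z /code_range[b <-] wb]] := wt.1.
have [s' [bt s'N _ s'u]] := IHs _ _ wt wb isT.
exists ((n, b) :: s'); rewrite /= nN; split=> //.
  by split=> //; apply: V_prefix => //; rewrite -ua -wb.
by rewrite /units big_cons -/(units N s') s'u [in RHS]big_cons.
Qed.

Lemma chain_step N s (a t : T) :
  chain V a s t -> all (fun e => e.1 <= N) s ->
  chain (step N) (prefix (margin P * N) (code a))
    [seq (e.1, prefix (margin P * N) (code e.2)) | e <- s]
    (prefix (margin P * N) (code t)).
Proof.
elim: s a => [|[n b] s IHs] a /= => [-> //|[ab bt] /andP[nN sN]].
split; last exact: IHs; split=> //.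
  by apply/near_code_prefix => //; rewrite leq_mul2l nN orbT.
by apply/mem_words; exists (code a) => //; apply/code_range; exists a.
Qed.

(** Chains of words lift to chains of points with the same number of units. Conversely, the
    projection of a chain of points can be freed of loops, after which it is short enough to be
    found by the search. *)
Lemma least_cost_spec N (a t : T) (o : oracle) :
  o false = code a -> o true = code t ->
  let admits s := [/\ chain V a s t, all (fun e => e.1 <= N) s & 0 < size s] in
  match least_cost M o P N with
  | 0 => forall s, ~ admits s
  | k.+1 => (exists2 s, admits s & units N s = k) /\
            forall s, admits s -> k <= units N s
  end.
Proof.
move=> oa ot admits; rewrite /least_cost; set m := margin P * N.
have -> : @vmap Nat Nat (fun n => ask o true n) (vrange (width M m)) =
  prefix m (code t) by rewrite /ask ot.
set K := vmap _ _.
have words_prefix b : prefix m (code b) \in (words M P m : seq (seq nat)).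
  by apply/mem_words; exists (code b) => //; apply/code_range; exists b.
have K_sound k : k \in (K : seq nat) -> exists2 s, admits s & units N s = k.
  move=> /mapP[us]; rewrite mem_filter => /andP[/allP us_a].
  move=> /mem_reachable[s [us_t sk us2]] ->.
  have us1 : us.1 = prefix m (code a).
    have [z us1] : exists z, us.1 = prefix m z.
      case: s us_t {sk us2} => [|e s] /= [].
        by move=> ->; exists (code t).
      by move=> [_ _ /mem_words[z _ ->]] _; exists z.
    rewrite us1; apply/eq_in_map => n n_m; have := us_a n n_m.
    rewrite /veqn /vnth /vfst us1 /ask oa => /eqP <-.
    by rewrite nth_mkseq //; move: n_m; rewrite mem_iota.
  case: s us_t sk us2 => [|e s] us_t sk us2.
    exists [:: (N, t)]; last by rewrite /vsnd -us2 /units !big_cons !big_nil subnn.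
    rewrite /admits /= leqnn; split=> //; split=> //.
    apply: (@nearby_agree _ _ _ _ (code t) _ (code t)) => //.
      by apply: agreeC => n nm; rewrite -(nth_mkseq 0 (code a) nm)
        -(nth_mkseq 0 (code t) nm) -!/(prefix m _) -us1 us_t.
    by apply: linked_nearby; apply/code_range; exists t.
  have [s' [at_ s'N s'0 s'u]] := step_chain us_t us1 isT.
  exists s' => //; rewrite s'u us2 /vsnd.
  by have := units_gt0 N (isT : 0 < size (e :: s)); rewrite us2; lia.
have K_complete s : admits s -> exists2 k, k \in (K : seq nat) & k <= units N s.
  move=> [at_ sN s0].
  have [s' [at' s's s'_uniq]] := uniq_chain (chain_step at_ sN).
  have us' : units N s' <= units N s.
    apply: leq_trans (units_subseq N s's) _.
    by rewrite /units big_map.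
  (* Removing loops may leave the empty chain; its cost, rounded up to 1, is still at most
     [units N s] because [s] is nonempty. *)
  exists (units N s' + (1 - units N s')); last first.
    by have := units_gt0 N s0; lia.
  apply/mapP; exists (prefix m (code a), units N s') => //.
  rewrite mem_filter; apply/andP; split.
    apply/allP => n; rewrite mem_iota => /= nm.
    by rewrite /veqn /vnth /vfst /ask oa nth_mkseq.
  apply/mem_reachable; exists s'; split=> //.
  (* The starting word and the targets are distinct elements of [words], so there are fewer steps
     than words. *)
  have -> : size s' = (size (prefix m (code a) :: map snd s')).-1.
    by rewrite /= size_map.
  apply: leq_trans (leq_pred _) _.
  apply: (uniq_leq_size s'_uniq) => u; rewrite inE => /orP[/eqP-> //|].
  have /allP words_s : all (fun e => e.2 \in (words M P m : seq (seq nat)))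
      [seq (e.1, prefix m (code e.2)) | e <- s].
    by rewrite all_map; elim: (s) => //= e s1 ->; rewrite words_prefix.
  by move=> /mapP[e es' ->]; exact/words_s/(mem_subseq s's).
have := leastP K; case: (least K) => [K0 s /K_complete[k]|k [kK k_le]].
  by rewrite K0.
split=> [|s /K_complete[l /k_le kl ls]]; first exact: K_sound.
exact: leq_trans kl ls.
Qed.

End Correctness.

(** * Topology of the full shift *)

Section ConfigTopology.
Local Open Scope classical_set_scope.
Variables (M : time) (S : finType).
Implicit Types (x y z : config M S) (K : set (config M S)).

Lemma eq_wordP m x y : word m x = word m y <->
  forall n, n < width M m -> x (idx_of_nat M n) = y (idx_of_nat M n).
Proof.
rewrite /word; case: M x y => x y; rewrite /window /width.
  split=> [/eq_in_map xy n nm|xy]; first by apply: xy; rewrite mem_iota.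
  by apply/eq_in_map => n; rewrite mem_iota => /= /xy.
have wE u : [seq (u i : S) | i <- [seq (i%:Z - m%:Z)%R | i <- iota 0 (2 * m).+1]] =
    [seq u (i%:Z - m%:Z)%R | i <- iota 0 (2 * m).+1] by elim: iota => //= k s ->.
rewrite !wE; split=> [/eq_in_map xy n nm|xy].
  rewrite /=; case: ifP => n_odd.
    have := xy (m - n./2.+1); rewrite mem_iota /= => /(_ ltac:(lia)).
    by have -> : ((m - n./2.+1)%:Z - m%:Z)%R = Negz n./2 by lia.
  have := xy (m + n./2); rewrite mem_iota /= => /(_ ltac:(lia)).
  by have -> : ((m + n./2)%:Z - m%:Z)%R = Posz n./2 by lia.
apply/eq_in_map => n; rewrite mem_iota => /= nm.
set i := (n%:Z - m%:Z)%R; rewrite -[i](@nat_of_idxK two_sided); apply: xy.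
have : i = (n%:Z - m%:Z)%R by []; case: i => k /=; lia.
Qed.

Lemma word_le m m' x y : m <= m' -> word m' x = word m' y -> word m x = word m y.
Proof.
move=> mm' /eq_wordP xy; apply/eq_wordP => n nm.
by apply: xy; apply: leq_trans nm (width_mono M mm').
Qed.

Lemma word_at m (i : idx M) x y : nat_of_idx i < width M m ->
  word m x = word m y -> x i = y i.
Proof. by move=> im /eq_wordP/(_ _ im); rewrite nat_of_idxK. Qed.

Lemma word_idx (i : idx M) x y : word (nat_of_idx i) x = word (nat_of_idx i) y -> x i = y i.
Proof.
by apply: word_at; case: (M) (nat_of_idx i) => k /=; lia.
Qed.

Lemma word_all x y : (forall m, word m x = word m y) -> x = y.
Proof. by move=> xy; apply/funext => i; exact/word_idx/xy. Qed.

#[local] Instance config_nbhs_filter x : ProperFilter (nbhs x).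
Proof. exact: (@nbhs_pfilter {ptws idx M -> discrete_topology S} x). Qed.

Lemma nbhs_word m x : nbhs x [set y | word m y = word m x].
Proof.
have coord (i : idx M) : nbhs x [set y | y i = x i].
  exact: (@proj_continuous {classic (idx M)} (fun=> discrete_topology S) i x _
    (discrete_set1 (x i : discrete_topology S))).
have first k : nbhs x [set y | forall n, n < k ->
    y (idx_of_nat M n) = x (idx_of_nat M n)].
  elim: k => [|k IHk]; first by apply: filterE => y n.
  apply: filterS2 IHk (coord (idx_of_nat M k)) => y yk ykx n.
  by rewrite ltnS leq_eqVlt => /orP[/eqP->|/yk].
by apply: filterS (first (width M m)) => y xy; apply/eq_wordP.
Qed.

(** The filter generated by the cylinders around [x] converges to [x] in each coordinate, hence in
    the product topology, so every neighbourhood contains a cylinder. *)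
Lemma nbhs_wordP x (U : set (config M S)) :
  nbhs x U <-> exists m, forall y, word m y = word m x -> U y.
Proof.
split=> [|[m mU]]; last by apply: filterS (nbhs_word m x).
pose C m := [set y : config M S | word m y = word m x].
have FF : ProperFilter (filter_from setT C).
  apply: filter_from_proper => [|m _]; last by exists x.
  apply: filter_from_filter => [|i j _ _]; first by exists 0.
  exists (maxn i j) => // y xy; split; apply: word_le xy.
    exact: leq_maxl.
  exact: leq_maxr.
suff : filter_from setT C --> x by move=> cvx /cvx[m _ mU]; exists m.
apply/cvg_sup => i U' [V [[W] oW <-] Wx WU].
exists (nat_of_idx i) => // y /word_idx xy; apply: WU.
by move: Wx; rewrite /= /proj xy.
Qed.

Lemma config_compact : compact [set: config M S].
Proof.
have S_compact : compact [set: discrete_topology S].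
  exact/finite_compact/(@finite_finset S).
have := @tychonoff {classic (idx M)} (fun=> discrete_topology S) (fun=> setT)
  (fun=> S_compact).
congr compact; apply/seteqP; split=> // x _ i //.
Qed.

Lemma closed_wordP K : closed K <->
  forall x, (forall m, exists2 y, K y & word m y = word m x) -> K x.
Proof.
split=> [clK x Kx|K_all x Kx].
  apply: clK => U /nbhs_wordP[m mU]; have [y Ky yx] := Kx m.
  by exists y; split=> //; exact: mU.
apply: K_all => m; have [y [Ky yx]] := Kx _ (nbhs_word m x).
by exists y.
Qed.

Lemma closed_accumulation K (u : nat -> config M S) : closed K ->
  (forall n, K (u n)) ->
  exists2 z, K z & forall m n, exists2 k, n <= k & word m (u k) = word m z.
Proof.
move=> clK Ku.
have Kc : compact K by apply: subclosed_compact clK config_compact _.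
have [|z [Kz z_cluster]] := Kc (u @ \oo) _.
  by exists 0 => // n _; exact: Ku.
exists z => // m n.
have [|_ [[k nk <-] kz]] := z_cluster (u @` [set k | n <= k]) _ _ (nbhs_word m z).
  by exists n => // k /= nk; exists k.
by exists k.
Qed.

End ConfigTopology.

(** * Sofic shifts are presented by automata *)

Definition add_idx M : idx M -> idx M -> idx M :=
  match M with one_sided => addn | two_sided => fun i j : int => (i + j)%R end.

Definition translate M (S : finType) (i : idx M) (x : config M S) : config M S :=
  fun j => x (add_idx i j).

Section Sofic.
Local Open Scope classical_set_scope.
Variables (M : time).
Local Notation zero := (idx_of_nat M 0).
Implicit Types i j : idx M.

Lemma add_idx0 i : add_idx i zero = i.
Proof. by rewrite /add_idx; case: M i => i /=; lia. Qed.

Lemma add_succ_idx i j : add_idx i (succ_idx j) = succ_idx (add_idx i j).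
Proof. by rewrite /add_idx; case: M i j => i j /=; lia. Qed.

Lemma add_advance i j (k : nat) : add_idx i (advance j k) = advance (add_idx i j) k.
Proof. by elim: k => //= k IHk; rewrite add_succ_idx IHk. Qed.

Lemma succ_add_idx i j : add_idx (succ_idx i) j = add_idx i (succ_idx j).
Proof. by rewrite /add_idx; case: M i j => i j /=; lia. Qed.

Lemma translate0 (S : finType) (x : config M S) : translate zero x = x.
Proof.
apply/funext => j; congr x; rewrite /add_idx; case: (M) j => j //=.
exact: add0r.
Qed.

Lemma shift_translate (S : finType) i (x : config M S) :
  shift_map (translate i x) = translate (succ_idx i) x.
Proof. by apply/funext => j; rewrite /shift_map /translate succ_add_idx. Qed.

Lemma sft_translate (S : finType) (F : seq (seq S)) i x :
  sft F x -> sft F (@translate M S i x).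
Proof.
move=> xF w wF [j wE]; apply: (xF w wF); exists (add_idx i j).
by rewrite {1}wE; apply: eq_map => k; rewrite /translate add_advance.
Qed.

Lemma sft_closed (S : finType) (F : seq (seq S)) : closed (@sft M S F).
Proof.
apply/closed_wordP => x x_sft w wF [i wE].
pose m := \max_(j < size w) nat_of_idx (advance i j).
have [y yF yx] := x_sft m; apply: (yF w wF); exists i.
rewrite {1}wE; apply/eq_in_map => j; rewrite mem_iota /= => jw.
apply/word_idx/(word_le _ (esym yx)).
exact: (leq_bigmax (Ordinal jw)).
Qed.

Lemma advance0_lt (j m : nat) : j <= m -> nat_of_idx (advance zero j) < width M m.
Proof.
move=> jm; rewrite /advance; case: M.
  by have -> : iter j (@succ_idx one_sided) 0 = j by elim: (j) => //= k ->.
have -> : iter j (@succ_idx two_sided) (Posz 0) = Posz j.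
  by elim: (j) => //= k ->; lia.
by rewrite /=; lia.
Qed.

(** The overlaps carry the letter at [j] of [X i] over to the letter at zero of [X] at the index
    [i + j], by induction on the distance of [j] from zero; all indices passed on the way lie in the
    window. *)
Lemma glue_blocks (G : finType) m (X : idx M -> config M G) :
  (forall i, word m (X (succ_idx i)) = word m (shift_map (X i))) ->
  forall i, word m (translate i (fun j => X j zero)) = word m (X i).
Proof.
move=> XS i; apply/eq_wordP => n nm.
have {}XS j k : nat_of_idx k < width M m -> X (succ_idx j) k = X j (succ_idx k).
  by move=> km; exact: word_at km (XS j).
move: nm; rewrite -{1}[n](@idx_of_natK M); move: (idx_of_nat M n) => j {n} jm.
rewrite /translate; case: M X XS i j jm => X XS i j.
  elim: j i => [|j IHj] i jm; first by rewrite [add_idx _ _]addn0.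
  rewrite -[j.+1]/(@succ_idx one_sided j) -XS; last exact: ltnW jm.
  by rewrite -(IHj (@succ_idx one_sided i) (ltnW jm)); congr (X _ _); exact/esym/addSnnS.
have pred (i0 : int) : i0 = @succ_idx two_sided (i0 - 1)%R by rewrite /=; lia.
case: j => k; elim: k i => [|k IHk] i km.
- by rewrite [add_idx _ _]addr0.
- have -> : Posz k.+1 = @succ_idx two_sided (Posz k) by rewrite /=; lia.
  have km' : nat_of_idx (Posz k : idx two_sided) < width two_sided m.
    by move: km => /=; lia.
  by rewrite -XS // -IHk //; congr (X _ _); rewrite /=; lia.
- rewrite [in RHS](pred i) XS; last by move: km => /=; lia.
  by congr (X _ _).
- rewrite [in RHS](pred i) XS //.
  have -> : succ_idx (Negz k.+1 : idx two_sided) = Negz k by rewrite /=; lia.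
  rewrite -IHk; last by move: km => /=; lia.
  by congr (X _ _); rewrite /=; lia.
Qed.

Section BlockMap.
Variables (G S : finType) (F : seq (seq G)) (f : config M G -> config M S).
Hypothesis f_cont : {within sft F, continuous f}.
Hypothesis f_shift : forall x, sft F x -> f (shift_map x) = shift_map (f x).

Lemma within_continuous_word z m : sft F z ->
  exists m', forall x, sft F x -> word m' x = word m' z ->
    word m (f x) = word m (f z).
Proof.
move=> Fz; move/subspace_continuousP: f_cont => /(_ z Fz) /(_ _ (nbhs_word m (f z))).
move=> /nbhs_wordP[m' m'P]; exists m' => x Fx xz; exact: m'P.
Qed.

(** Points whose images match [x] on larger and larger windows accumulate in the compact subshift of
    finite type; by continuity the accumulation point is mapped to [x]. *)
Lemma block_map_closed : closed (f @` sft F).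
Proof.
apply/closed_wordP => x x_lim.
have /choice[u uP] m : exists u, sft F u /\ word m (f u) = word m x.
  by have [_ [u Fu <-] ux] := x_lim m; exists u.
have [z Fz z_acc] := closed_accumulation (@sft_closed G F) (fun n => (uP n).1).
exists z => //; apply: word_all => m.
have [m' m'P] := within_continuous_word m Fz.
have [k mk kz] := z_acc m' m.
by rewrite -(m'P _ (uP k).1 kz); exact: word_le mk (uP k).2.
Qed.

(** Commutation with the shift gives the translations by nonnegative indices. A translation by a
    negative index is the inverse of one of these and preserves the subshift of finite type. *)
Lemma f_translate i x : sft F x -> f (translate i x) = translate i (f x).
Proof.
have nonneg k y : sft F y ->
    f (translate (iter k (@succ_idx M) zero) y) =
    translate (iter k (@succ_idx M) zero) (f y).
  move=> Fy; elim: k => [|k IHk]; first by rewrite !translate0.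
  by rewrite -!shift_translate f_shift ?IHk //; exact: sft_translate.
have [k [<-|ik]] : exists k, iter k (@succ_idx M) zero = i \/
    (forall T : finType, cancel (@translate M T i) (translate (iter k (@succ_idx M) zero))
     /\ cancel (@translate M T (iter k (@succ_idx M) zero)) (translate i)).
- have one k : iter k (@succ_idx one_sided) 0 = k by elim: k => //= k ->.
  have two k : iter k (@succ_idx two_sided) (Posz 0) = Posz k.
    by elim: k => //= k ->; lia.
  rewrite /translate /add_idx; case: M i => [k|[k|k]].
  + by exists k; left; rewrite one.
  + by exists k; left; rewrite two.
  + exists k.+1; right=> T; split=> y; apply/funext => j; rewrite two;
      congr y; rewrite /=; lia.
- exact: nonneg.
move=> Fx; rewrite -{2}[x](ik G).1 nonneg; last exact: sft_translate.
by rewrite (ik S).2.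
Qed.

(* Curtis-Hedlund-Lyndon. *)
Lemma local_rule : exists r, forall x x', sft F x -> sft F x' ->
  word r x = word r x' -> f x zero = f x' zero.
Proof.
apply: contrapT => no_rule.
have /choice[u uP] r : exists u : config M G * config M G,
    [/\ sft F u.1, sft F u.2, word r u.1 = word r u.2 & f u.1 zero <> f u.2 zero].
  apply: contrapT => no_u; apply: no_rule; exists r => x x' Fx Fx' xx'.
  by apply: contrapT => fxx'; apply: no_u; exists (x, x').
have u1F n : sft F (u n).1 by have [] := uP n.
(* Pairs that agree on growing windows but have different images accumulate at one common point,
   where continuity is contradicted. *)
have [z Fz z_acc] := closed_accumulation (@sft_closed G F) u1F.
have [m mP] := within_continuous_word 0 Fz.
have [k mk kz] := z_acc m m; have [_ u2F kk] := uP k; apply.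
have zeroP y : sft F y -> word m y = word m z -> f y zero = f z zero.
  by move=> Fy /(mP _ Fy)/eq_wordP; apply; case: (M).
by rewrite !zeroP // -kz; apply: esym; exact: word_le mk kk.
Qed.

(** The higher block presentation: states are the blocks on a window, and each point of the subshift
    of finite type contributes an edge from its block to that of its shift, labelled by the letter
    of its image at zero. *)
Lemma block_map_presented : exists A : automaton S, presents A (f @` sft F).
Proof.
have [r rP] := local_rule.
(* A block has to determine the label of its edge, which takes [r], and to be long enough to exhibit
   every forbidden word. *)
pose m := maxn r (\max_(w <- F) size w).
pose block x : (size (window M m)).-tuple G :=
  map_tuple (fun i => x i : G) (in_tuple (window M m)).
have blockE x x' : block x = block x' <-> word m x = word m x'.
  by split=> [/(congr1 val)|xx']; [ | exact: val_inj].
pose is_edge u s v := exists2 x, sft F x &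
  [/\ u = block x, s = f x zero & v = block (shift_map x)].
pose A : automaton S := [seq (pickle e.1.1, e.1.2, pickle e.2) |
  e <- enum {: _.-tuple G * S * _.-tuple G} & `[< is_edge e.1.1 e.1.2 e.2 >]].
have AP q s q' : (q, s, q') \in A <->
    exists u v, [/\ q = pickle u, q' = pickle v & is_edge u s v].
  split=> [/mapP[[[u t] v]]|[u [v [-> -> uv]]]].
    rewrite mem_filter => /andP[/asboolP uv _] [-> -> ->].
    by exists u, v.
  apply/mapP; exists ((u, s), v) => //.
  by rewrite mem_filter mem_enum andbT; exact/asboolP.
exists A; apply/seteqP; split=> [_ [x Fx <-]|y [q qP]] /=.
  exists (fun i => pickle (block (translate i x))) => i; apply/AP.
  exists (block (translate i x)), (block (translate (succ_idx i) x)); split=> //.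
  exists (translate i x); first exact: sft_translate.
  by rewrite shift_translate f_translate // /translate add_idx0.
have /choice[X XP] i : exists x, [/\ sft F x, q i = pickle (block x),
    y i = f x zero & q (succ_idx i) = pickle (block (shift_map x))].
  by have /AP[u [v [-> -> [x Fx [-> -> ->]]]]] := qP i; exists x.
(* Consecutive edges share a state, hence a block, so the points chosen for them overlap and can be
   glued. *)
pose x : config M G := fun j => X j zero.
have xX i : word m (translate i x) = word m (X i).
  apply: glue_blocks => j; apply/blockE/(pcan_inj pickleK).
  by have [_ _ _ <-] := XP j; have [_ <-] := XP (succ_idx j).
have Fx : sft F x.
  move=> w wF [i wE]; have [XF _ _ _] := XP i; apply: (XF w wF); exists zero.
  rewrite {1}wE; apply/eq_in_map => j; rewrite mem_iota => /= jw.
  rewrite -[i in LHS]add_idx0 -add_advance -/(translate i x _).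
  apply: word_at (xX i); apply: advance0_lt; rewrite leq_max; apply/orP; right.
  by apply: leq_trans (ltnW jw) _; exact: leq_bigmax_seq.
exists x => //; apply/funext => i.
rewrite -[i in LHS]add_idx0 -/(translate i (f x) zero) -f_translate //.
have [XF _ -> _] := XP i.
apply: rP => //; first exact: sft_translate.
by apply: word_le (xX i); exact: leq_maxl.
Qed.

End BlockMap.
End Sofic.

(** * Coding of configurations *)

(** This is also the sequence of answers of the oracle for [x], so the correctness of the search
    applies to the oracles directly. *)
Definition coding M (S : finType) (x : config M S) : nat -> nat :=
  fun n => letter_code (x (idx_of_nat M n) : S).

Lemma letter_code_inj (S : finType) : injective (@letter_code S).
Proof. by move=> s t /ord_inj/enum_rank_inj. Qed.

Lemma nat_of_succ_idx M (i : idx M) :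
  nat_of_idx (succ_idx i) = succ_code M (nat_of_idx i).
Proof. by rewrite -[i in LHS]nat_of_idxK succ_idxE idx_of_natK. Qed.

Lemma agree_code M (S : finType) m (x y : config M S) :
  agree M m (coding x) (coding y) <-> word m x = word m y.
Proof.
rewrite eq_wordP; split=> xy n /xy; first exact: letter_code_inj.
by rewrite /coding => ->.
Qed.

Lemma code_inj M (S : finType) : injective (@coding M S).
Proof.
move=> x y xy; apply: word_all => m; apply/agree_code.
by rewrite xy.
Qed.

Section Presentations.
Variables (M : time) (S : finType) (Y : set (config M S)).
Variables (Z : set (config M (S * S)%type)).
Variables (A : automaton S) (B : automaton (S * S)%type).
Hypotheses (AY : presents A Y) (BZ : presents B Z).

Lemma code1_path (u : nat -> nat) :
  (exists q : nat -> nat, forall n,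
    ((q n, u n, q (succ_code M n)) : nat * nat * nat) \in (code1 A : seq _)) <->
  exists2 x, Y x & u = coding x.
Proof.
split=> [[q qP]|[x]].
  have /choice[s sP] n : exists s, (q n, s, q (succ_code M n)) \in A /\ u n = letter_code s.
    by have /mapP[[[a s] b] eA [-> -> ->]] := qP n; exists s.
  exists (fun i => s (nat_of_idx i)).
    rewrite AY; exists (q \o (@nat_of_idx M)) => i /=.
    by rewrite nat_of_succ_idx; have [] := sP (nat_of_idx i).
  by apply/funext => n; rewrite /coding idx_of_natK; have [] := sP n.
rewrite {1}AY => -[q qP] ->; exists (q \o idx_of_nat M) => n /=.
by apply/mapP; have := qP (idx_of_nat M n); rewrite succ_idxE; exists (q (idx_of_nat M n),
  x (idx_of_nat M n) : S, q (idx_of_nat M (succ_code M n))).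
Qed.

Lemma code2_path (x y : config M S) :
  (exists q : nat -> nat, forall n,
    ((q n, (coding x n, coding y n), q (succ_code M n)) : nat * (nat * nat) * nat)
      \in (code2 B : seq _)) <-> Z (pairing x y).
Proof.
split=> [[q qP]|].
  rewrite BZ; exists (q \o (@nat_of_idx M)) => i /=.
  have /mapP[[[a [s t]] b] eB [-> ]] := qP (nat_of_idx i).
  rewrite /coding nat_of_idxK nat_of_succ_idx /pairing.
  by move=> /letter_code_inj-> /letter_code_inj-> ->.
rewrite {1}BZ => -[q qP]; exists (q \o idx_of_nat M) => n /=.
apply/mapP; have := qP (idx_of_nat M n); rewrite succ_idxE.
by exists (q (idx_of_nat M n), pairing x y (idx_of_nat M n) : S * S,
  q (idx_of_nat M (succ_code M n))).
Qed.

Local Notation P := (fibre (code1 A) (code2 B)).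
Local Notation linkedP := (linked M
  (P : seq (nat * (nat * nat) * (nat * nat) * (nat * (nat * nat))))).
Local Notation nearbyP := (nearby M
  (P : seq (nat * (nat * nat) * (nat * nat) * (nat * (nat * nat))))).

Lemma linked_code (u v : nat -> nat) : linkedP u v <->
  exists x y, [/\ Y x, Y y, Z (pairing x y), u = coding x & v = coding y].
Proof.
rewrite linked_fibre; split=> [[/code1_path[x Yx ->] /code1_path[y Yy ->] /code2_path Zxy]|].
  by exists x, y.
move=> [x [y [Yx Yy Zxy -> ->]]]; split; last exact/code2_path.
  by apply/code1_path; exists x.
by apply/code1_path; exists y.
Qed.

Lemma linked_codeE (x y : Y) :
  linkedP (coding (set_val x)) (coding (set_val y)) <-> Z (pairing (set_val x) (set_val y)).
Proof.
rewrite linked_code; split=> [[x' [y' [_ _ Zxy /code_inj-> /code_inj->]]] //|Zxy].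
by exists (set_val x), (set_val y); split=> //; exact: set_valP.
Qed.

Lemma edge_nearby m (x y : config M S) :
  edge Y Z m (word m x) (word m y) <-> nearbyP m (coding x) (coding y).
Proof.
split=> [[x' [y' [Yx' Yy' xx' yy' Zxy]]]|[u [v [/linked_code[x' [y' [Yx' Yy' Zxy -> ->]]]]]]].
  exists (coding x'), (coding y'); split; [|exact/agree_code..].
  by apply/linked_code; exists x', y'.
by move=> /agree_code xx' /agree_code yy'; exists x', y'.
Qed.

Hypothesis hZ : equiv_class_of (glued Y Z).

Lemma gluedP (x y : Y) : reflect (Z (pairing (set_val x) (set_val y))) (glued Y Z x y).
Proof. exact: asboolP. Qed.

Lemma linked_class u v : linkedP u v ->
  exists x y : Y, [/\ glued Y Z x y, u = coding (set_val x) & v = coding (set_val y)].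
Proof.
move=> /linked_code[x [y [/mem_set Yx /mem_set Yy Zxy -> ->]]].
by exists (exist _ x Yx), (exist _ y Yy); split=> //; apply/gluedP.
Qed.

Lemma class_linked (x y : Y) : glued Y Z x y -> linkedP (coding (set_val x)) (coding (set_val y)).
Proof. by move=> /gluedP; exact: (linked_codeE x y).2. Qed.

Lemma code_set_val_inj (x y : Y) : coding (set_val x) = coding (set_val y) -> x = y.
Proof. by move=> /code_inj/val_inj. Qed.

Lemma linkedP_refl u v : linkedP u v -> linkedP u u.
Proof.
case: hZ => refl _ _ /linked_class[x [y [_ -> _]]]; exact/class_linked/refl.
Qed.

Lemma linkedP_sym u v : linkedP u v -> linkedP v u.
Proof.
case: hZ => _ sym _ /linked_class[x [y [xy -> ->]]].
by apply: class_linked; rewrite sym.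
Qed.

Lemma linkedP_trans u v w : linkedP u v -> linkedP v w -> linkedP u w.
Proof.
case: hZ => _ _ trans /linked_class[x [y [xy -> ->]]].
move=> /linked_class[y' [z [yz /code_set_val_inj yy' ->]]].
by apply: class_linked; apply: trans xy _; rewrite yy'.
Qed.

Lemma code_rangeP u : linkedP u u <-> exists t : Y, coding (set_val t) = u.
Proof.
split=> [/linked_class[x [_ [_ -> _]]]|[t <-]]; first by exists x.
by case: hZ => refl _ _; exact/class_linked/refl.
Qed.

End Presentations.

(** * The metric on the quotient *)

Section Metric.
Local Open Scope classical_set_scope.
Local Open Scope ereal_scope.
Variables (R : realType) (M : time) (S : finType) (Y : set (config M S)).
Variables (Z : set (config M (S * S)%type)).
Variables (A : automaton S) (B : automaton (S * S)%type).
Hypotheses (AY : presents A Y) (BZ : presents B Z).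
Hypotheses (Y_closed : closed Y) (Z_closed : closed Z).
Hypothesis hZ : equiv_class_of (glued Y Z).

Local Notation P := (fibre (code1 A) (code2 B)).
Local Notation c := (margin P).
Local Notation nearbyP := (nearby M
  (P : seq (nat * (nat * nat) * (nat * nat) * (nat * (nat * nat))))).

Definition close (n : nat) (x y : Y) : Prop :=
  nearbyP (c * n) (coding (set_val x)) (coding (set_val y)).

Lemma close_refl n x : close n x x.
Proof. by apply: linked_nearby; apply/(code_rangeP AY BZ hZ); exists x. Qed.

Lemma close_sym n x y : close n x y -> close n y x.
Proof. by apply: nearby_sym; exact: (linkedP_sym AY BZ hZ). Qed.

(** Consecutive windows $cn$ and $c(n+1)$ differ by the margin that [nearby_cube] loses; this is the
    reason for using multiples of $c$. *)
Lemma close_cube n x y z w :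
  close n.+1 x y -> close n.+1 y z -> close n.+1 z w -> close n x w.
Proof.
rewrite /close mulnSr; apply: nearby_cube; first exact: (linkedP_trans AY BZ hZ).
exact: leqnSn.
Qed.

Lemma glued_close n x y : glued Y Z x y -> close n x y.
Proof. by move=> xy; exact/linked_nearby/(class_linked AY BZ). Qed.

Lemma close_edge n x y :
  edge Y Z (c * n) (word (c * n) (set_val x)) (word (c * n) (set_val y)) <->
  close n x y.
Proof. exact: edge_nearby. Qed.

Lemma le_margin_mul n : (n <= c * n)%N.
Proof. by rewrite leq_pmull. Qed.

Lemma close_word n (x x' y y' : Y) :
  word (c * n) (set_val x) = word (c * n) (set_val x') ->
  word (c * n) (set_val y) = word (c * n) (set_val y') ->
  close n x y -> close n x' y'.
Proof. by move=> /agree_code xx' /agree_code yy'; exact: nearby_agree. Qed.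

(** The pair is a limit of pairs in $Z$, which is closed. *)
Lemma close_glued x y : (forall n, close n x y) -> glued Y Z x y.
Proof.
move=> xy; apply/gluedP; move/closed_wordP: Z_closed; apply => m.
have /close_edge[x' [y' [_ _ xx' yy' Zxy]]] := xy m.
exists (pairing x' y') => //; apply/eq_wordP => n nm; rewrite /pairing.
move/eq_wordP: (word_le (le_margin_mul m) xx') => /(_ n nm) ->.
by move/eq_wordP: (word_le (le_margin_mul m) yy') => /(_ n nm) ->.
Qed.

Definition dist : Y -> Y -> \bar R := chain_dist R close.

Lemma close_dist n x y : close n x y -> dist x y <= (weight R n)%:E.
Proof. exact: near_chain_dist. Qed.

Lemma point_dist_scale n (e : \bar R) :
  e / ((2 : R) ^ (n%:Z - 1))%:E = e * (weight R n)%:E.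
Proof.
have -> : ((2 : R) ^ (n%:Z - 1) = (weight R n)^-1)%R.
  by rewrite /weight invf_div expfzDr ?pnatr_eq0 // exprN1.
by rewrite inver invr_eq0 gt_eqF ?weight_gt0 // invrK.
Qed.

Lemma dist_pseudometric : pseudometric dist.
Proof.
split.
- exact: chain_dist_ge0.
- exact: chain_distxx.
- by move=> x y; apply: chain_dist_sym => *; exact: close_sym.
- exact: chain_dist_triangle.
Qed.

(** A walk passes through words only. Each intermediate word is that of a point of $Y$, and the
    choice of the point is immaterial because [close] sees only words. *)
Lemma walk_dist n l (x y : Y) : (0 < l)%N ->
  walk (edge Y Z (c * n)) l (word (c * n) (set_val x)) (word (c * n) (set_val y)) ->
  dist x y <= (l%:R * weight R n)%:E.
Proof.
elim: l x => // -[|l] IHl x _.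
  move=> [w xw wy]; rewrite mul1r.
  by apply/close_dist/close_edge; rewrite -[X in edge _ _ _ _ X]wy.
move=> [w xw wy]; have [x' [z [_ /mem_set Yz _ zw _]]] := xw.
rewrite -[z]/(set_val (exist _ z Yz : Y)) in zw.
have [_ _ _ /(_ x (exist _ z Yz) y) dist_tri] := dist_pseudometric.
apply: le_trans dist_tri _.
rewrite -natr1 mulrDl mul1r EFinD addeC.
apply: leeD; first by apply/close_dist/close_edge; rewrite zw.
by apply: IHl => //; rewrite zw.
Qed.

Lemma dist_admissible : admissible Z c dist.
Proof.
split; first exact: dist_pseudometric.
move=> x y n; rewrite point_dist_scale.
rewrite -lee_pdivrMr ?weight_gt0 // /point_dist /graph_dist.
apply: le_ereal_inf_tmp => _ [l [l0 xy] <-].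
by rewrite lee_pdivrMr ?weight_gt0 // -EFinM; exact: walk_dist.
Qed.

(** An edge is a walk of length one, so admissibility bounds [d] by the cost of each single step;
    the triangle inequality does the rest. *)
Lemma admissible_le d : admissible Z c d -> forall x y, d x y <= dist x y.
Proof.
move=> [[d0 dxx d_sym d_tri] d_le]; apply: chain_dist_greatest => // n x y.
move=> /close_edge xy; apply: le_trans (d_le x y n) _.
rewrite point_dist_scale -[leRHS]mul1e lee_pmul2r ?lte_fin ?weight_gt0 //.
apply: ereal_inf_lbound; exists 1%N => //; split=> //.
by exists (word (c * n) (set_val y)).
Qed.

(** Uniqueness follows because [dist] is not just maximal but the greatest admissible function. *)
Lemma dist_maximal : unique (maximal_admissible Z c) dist.
Proof.
have le_antisym (d d' : Y -> Y -> \bar R) :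
    (forall x y, d x y <= d' x y) -> (forall x y, d' x y <= d x y) -> d = d'.
  move=> dd' d'd; apply/funext => x; apply/funext => y.
  by apply/eqP; rewrite eq_le dd' d'd.
split.
  split=> [|d' /admissible_le d'_le le_d']; first exact: dist_admissible.
  exact: le_antisym.
move=> d' [/[dup] d'_adm /admissible_le d'_le]; apply => //.
exact: dist_admissible.
Qed.

Lemma dist_finite (x y : Y) : point_dist R Z 0 x y < +oo -> dist x y < +oo.
Proof.
have [_ /(_ x y 0%N)] := dist_admissible; rewrite muln0 point_dist_scale => le_d fin_d.
apply: le_lt_trans le_d _; move: fin_d.
have : 0 <= point_dist R Z 0 x y.
  by apply: le_ereal_inf_tmp => _ [l _ <-]; rewrite lee_fin.
by case: (point_dist R Z 0 x y) => [r| |] //= r0 _; rewrite -EFinM ltry.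
Qed.

Lemma dist_close n x y : dist x y < (weight R n)%:E -> close n x y.
Proof. by apply: chain_dist_near; [exact: close_refl | exact: close_cube]. Qed.

Lemma dist_eq0 x y : dist x y = 0 <-> glued Y Z x y.
Proof.
split=> [d0|xy].
  by apply: close_glued => n; apply: dist_close; rewrite d0 lte_fin weight_gt0.
apply/eqP; rewrite eq_le chain_dist_ge0 andbT.
apply/lee_addgt0Pr => e /(@weight_small R)[n ne]; rewrite add0e.
apply: (@le_trans _ _ (weight R n)%:E); last by rewrite lee_fin ltW.
exact/close_dist/glued_close.
Qed.

Lemma dist_glued x x' y y' : glued Y Z x x' -> glued Y Z y y' -> dist x y = dist x' y'.
Proof.
have [_ _ sym tri] := dist_pseudometric.
suff le u u' v v' : glued Y Z u u' -> glued Y Z v v' -> dist u v <= dist u' v'.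
  case: hZ => _ glued_sym _ xx' yy'.
  by apply/eqP; rewrite eq_le !le // glued_sym.
move=> /dist_eq0 uu' /dist_eq0 vv'.
apply: le_trans (tri u u' v) _; rewrite uu' add0e.
by apply: le_trans (tri u' v' v) _; rewrite [dist v' v]sym vv' adde0.
Qed.

Lemma open_set_wordP (O : set Y) : open O <->
  forall x, O x -> exists m, forall y : Y, word m (set_val y) = word m (set_val x) -> O y.
Proof.
have nbhsP x : nbhs x O <->
    exists m, forall y : Y, word m (set_val y) = word m (set_val x) -> O y.
  have Yx : Y (set_val x) by exact: set_valP.
  apply: (iff_trans (@subspace_subtypeP {ptws idx M -> discrete_topology S} Y x O)).
  change (nbhs_subspace (set_val x : subspace Y) (set_val @` O) <->
    exists m, forall y : Y, word m (set_val y) = word m (set_val x) -> O y).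
  rewrite -(nbhs_subspace_in Yx).
  apply: (iff_trans (nbhs_wordP (set_val x) [set z | Y z -> (set_val @` O) z])).
  split=> -[m mO]; exists m => y yx.
    have [y' Oy' /val_inj <-] := mO _ yx (set_valP y).
    exact: Oy'.
  move=> Yy; exists (exist _ y (mem_set Yy)) => //.
  exact: mO.
by rewrite openE; split=> O_nbhs x Ox; apply/nbhsP/O_nbhs.
Qed.

Lemma quotient_openP (U : set (quotient_space hZ)) : open U <->
  forall x : Y, U (\pi x)%qT -> exists m, forall y : Y,
    word m (set_val y) = word m (set_val x) -> U (\pi y)%qT.
Proof. exact: (open_set_wordP [set x : Y | U (\pi x)%qT]). Qed.

Lemma pi_glued x y : ((\pi x : quotient_space hZ) = \pi y)%qT <-> glued Y Z x y.
Proof. by split=> [/eqmodP|xy] //; exact/eqmodP. Qed.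

Lemma repr_pi_glued x : glued Y Z (repr (\pi x : quotient_space hZ)%qT) x.
Proof. by apply/pi_glued; rewrite reprK. Qed.

(** Points with the same word on the window $cn$ are at distance at most [weight R n], so sets
    containing balls are open. Conversely, if an open [U] contained no ball around [p], points
    outside [U] with distances to [p] tending to 0 would accumulate at a point that is equivalent to
    [p] and yet outside [U]. *)
Lemma metrizes_dist : metrizes hZ dist.
Proof.
split=> [x y|U].
  by rewrite dist_eq0; split=> [/gluedP|Zxy] //; exact/gluedP.
rewrite quotient_openP; split=> [U_open p Up|U_ball x Ux]; last first.
  have [e e0 eU] := U_ball _ Ux; have [n ne] := weight_small e0.
  exists (c * n)%N => y yx; apply: eU.
  rewrite /quotient_dist (dist_glued (repr_pi_glued x) (repr_pi_glued y)).
  apply: (@le_lt_trans _ _ (weight R n)%:E); last by rewrite lte_fin.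
  by apply/close_dist/(close_word _ _ (close_refl n x)).
apply: contrapT => no_ball.
have /choice[q qP] n : exists q, dist (repr p) (repr q) < (weight R n)%:E /\ ~ U q.
  apply: contrapT => no_q; apply: no_ball; exists (weight R n) => [|q pq].
    exact: weight_gt0.
  by apply: contrapT => Uq; apply: no_q; exists q.
(* The preimage of the complement of [U]; it is closed, which keeps the accumulation point outside
   [U]. *)
pose K := [set set_val t | t in [set t : Y | ~ U (\pi t)%qT]].
have K_closed : closed K.
  apply/closed_wordP => x x_lim.
  have Yx : Y x.
    move/closed_wordP: Y_closed; apply => m.
    by have [_ [t _ <-] tx] := x_lim m; exists (set_val t) => //; exact: set_valP.
  exists (exist _ x (mem_set Yx)) => //= /U_open[m mU].
  by have [_ [t Ut <-] tx] := x_lim m; exact/Ut/mU.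
have Kq n : K (set_val (repr (q n))).
  by exists (repr (q n)) => //=; rewrite reprK; exact: (qP n).2.
have [_ [t Ut <-] t_acc] := closed_accumulation K_closed Kq.
apply: Ut; suff /pi_glued <- : glued Y Z (repr p) t by rewrite reprK.
apply: close_glued => n; have [k nk kt] := t_acc (c * n)%N n.
apply: (close_word (erefl _) kt).
by apply: nearby_le (dist_close (qP k).1); rewrite leq_mul2l nk orbT.
Qed.

Lemma dist_upto_least_cost N (x y : Y) :
  chain_dist_upto R close N x y =
  match least_cost M (oracles (set_val x) (set_val y)) P N with
  | 0%N => +oo
  | k.+1 => (k%:R * weight R N)%:E
  end.
Proof.
have := least_cost_spec (linkedP_refl AY BZ hZ)
  (code_rangeP AY BZ hZ) N (a := x) (t := y)
  (o := oracles (set_val x) (set_val y)) erefl erefl.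
case: (least_cost _ _ _ _) => [none|k [[s [xy sN s0] <-] k_le]].
  rewrite /chain_dist_upto (_ : [set s | _] = set0) ?image_set0 ?ereal_inf0 //.
  by apply/seteqP; split=> // s /none.
apply/eqP; rewrite eq_le; apply/andP; split.
  by rewrite -(cost_units R sN); apply: ereal_inf_lbound; exists s.
apply: le_ereal_inf_tmp => _ [s' [xy' s'N s'0] <-].
rewrite (cost_units R s'N) lee_fin ler_pM2r ?weight_gt0 // ler_nat.
exact: k_le.
Qed.

Lemma erational_weight k N : erational R (k, 2 ^ N)%N = (k%:R * weight R N / 2)%:E.
Proof.
rewrite /erational /= inver pnatr_eq0 expn_eq0 /= -EFinM; congr (_%:E).
by rewrite /weight natrX; field; rewrite expf_neq0.
Qed.

Lemma erational_oo : erational R (1, 0)%N = +oo.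
Proof. by rewrite /erational /= inver eqxx mul1e. Qed.

Lemma erational_upper_bound N (x y : Y) :
  erational R (upper_bound (least_cost M (oracles (set_val x) (set_val y)) P N) N) =
  chain_dist_upto R close N x y.
Proof.
rewrite dist_upto_least_cost /upper_bound /vif /veqn.
case: (least_cost _ _ _ _) => [|k] /=; first exact: erational_oo.
rewrite erational_weight natrM; congr (_%:E).
by field.
Qed.

Lemma upper_bound_semicomputes
  (enumerate : prog (Prod (Prod Edges1 Edges2) Nat) Rational) :
  (forall o v, run o enumerate v (upper_bound
    (least_cost M o (fibre (vfst (vfst v)) (vsnd (vfst v))) (vsnd v)) (vsnd v))) ->
  upper_semicomputed A B enumerate dist.
Proof.
move=> enumerateP x y.
exists (fun N => upper_bound (least_cost M (oracles (set_val x) (set_val y)) P N) N).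
split=> [k|k|]; first exact: (enumerateP _ ((code1 A, code2 B), k)).
  by rewrite erational_upper_bound; exact: chain_dist_le_upto.
rewrite (_ : (fun k => _) = fun N => chain_dist_upto R close N x y).
  by apply: chain_dist_upto_cvg; exact: close_refl.
by apply/funext => N; exact: erational_upper_bound.
Qed.

(** For the tolerance [a / b] the level $N = b+1$ suffices, since $2^{1-N} = 2^{-b} \le 1/b \le
    a/b$; no logarithm has to be computed. *)
Lemma weight_le_erational (a b : nat) : (0 < a)%N -> (0 < b)%N ->
  erational R (a, b) = (a%:R / b%:R)%:E /\ (weight R b.+1 <= a%:R / b%:R)%R.
Proof.
move=> a0 b0; have b0R : (0 < b%:R :> R)%R by rewrite ltr0n.
rewrite /erational /= inver gt_eqF //; split=> //.
rewrite /weight exprS invfM mulrA mulfV ?pnatr_eq0 // mul1r.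
apply: (@le_trans _ _ (b%:R^-1)%R).
  by rewrite lef_pV2 ?posrE ?exprn_gt0 // -natrX ler_nat ltnW // ltn_expl.
by apply: ler_peMl; rewrite ?ler1n // invr_ge0 ltW.
Qed.

(** With $w_N$ the minimal cost and $r = (w_N - 2^{1-N})/2$, the bound $w_N \le 2d + 2^{1-N}$ says
    $r \le d$, and $d \le w_N = 2r + 2^{1-N}$ is at most $\frac52 r$ plus the tolerance. *)
Lemma lower_bound_approximates
  (approximate : prog (Prod (Prod Edges1 Edges2) Rational) Rational) :
  (forall o v, run o approximate v (lower_bound
    (least_cost M o (fibre (vfst (vfst v)) (vsnd (vfst v)))
      (@vsnd Nat Nat (vsnd v)).+1) (@vsnd Nat Nat (vsnd v)).+1)) ->
  approximated A B approximate dist.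
Proof.
move=> approximateP x y [a b] /= a0 b0.
pose N := b.+1; pose w := least_cost M (oracles (set_val x) (set_val y)) P N.
have [le_d d_le] : erational R (lower_bound w N) <= dist x y /\
    dist x y <= (5 / 2)%:E * erational R (lower_bound w N) + erational R (a, b);
  last first.
  by exists (lower_bound w N).
have [-> w_le] := weight_le_erational a0 b0.
have := chain_dist_upto_le R close_refl close_cube N x y.
have := chain_dist_le_upto R close N x y.
have : 0 <= dist x y by exact: chain_dist_ge0.
rewrite dist_upto_least_cost -/w -/(dist x y) /lower_bound /vif /veqn.
(* If no chain of levels at most [N] exists, the factor-two bound forces the distance to be
   infinite, in accordance with the output [(1, 0)]. *)
case: w => [|k] /=.
  rewrite erational_oo; case: (dist x y) => [t| |] // _ _ _.
  by rewrite gt0_muley ?lte_fin ?divr_gt0.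
rewrite erational_weight; case: (dist x y) => [t| |] //.
rewrite -!EFinM -!EFinD !lee_fin => t0 t_le le_t.
have w0 := weight_gt0 R N; rewrite -/N in w_le.
(* For [k = 0] the truncated predecessor gives the lower bound 0, which is exact because the
   distance is then 0 as well. *)
case: k t_le le_t => [|k] /= t_le le_t; first by split; lra.
move: t_le le_t; rewrite -natr1; have : (0 <= k%:R * weight R N)%R.
  by rewrite mulr_ge0 // ltW.
by split; lra.
Qed.

End Metric.

Lemma sofic_closed M (S : finType) (Y : set (config M S)) : sofic Y -> closed Y.
Proof. by move=> [G [F [f [f_cont _ ->]]]]; exact: block_map_closed. Qed.

Lemma sofic_presented M (S : finType) (Y : set (config M S)) : sofic Y ->
  exists A : automaton S, presents A Y.
Proof. by move=> [G [F [f [f_cont f_shift ->]]]]; exact: block_map_presented. Qed.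

Local Open Scope ereal_scope.

Theorem theorem1p6 (R : realType) (M : time) :
  exists (enumerate : prog (Prod (Prod Edges1 Edges2) Nat) Rational)
         (approximate : prog (Prod (Prod Edges1 Edges2) Rational) Rational),
  forall (S : finType) (Y : set (config M S)) (Z : set (config M (S * S)%type)),
  sofic Y -> sofic Z ->
  forall hZ : equiv_class_of (glued Y Z),
  (exists (A : automaton S) (B : automaton (S * S)%type),
     presents A Y /\ presents B Z) /\
  forall (A : automaton S) (B : automaton (S * S)%type),
  presents A Y -> presents B Z ->
  exists (c : nat) (d : Y -> Y -> \bar R),
    [/\ unique (maximal_admissible Z c) d,
        (forall x y : Y, point_dist R Z 0 x y < +oo -> d x y < +oo),
        metrizes hZ d,
        upper_semicomputed A B enumerate d
      & approximated A B approximate d].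
Proof.
have [enumerate enumerateP] := computable_upper_bound M.
have [approximate approximateP] := computable_lower_bound M.
exists enumerate, approximate => S Y Z sY sZ hZ; split.
  have [A AY] := sofic_presented sY; have [B BZ] := sofic_presented sZ.
  by exists A, B.
move=> A B AY BZ; have Y_closed := sofic_closed sY; have Z_closed := sofic_closed sZ.
exists (margin (fibre (code1 A) (code2 B))), (@dist R M S Y A B); split.
- exact: dist_maximal.
- exact: dist_finite.
- exact: metrizes_dist.
- exact: (upper_bound_semicomputes R AY BZ hZ enumerateP).
- exact: (lower_bound_approximates R AY BZ hZ approximateP).
Qed.
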